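(* Let $j\geqslant 1$ be an integer, $\kappa_1,\kappa_2>0$, $\alpha\in(0,1)$, and $\lambda_i>0$ for $i\in\mathbb{N}$, $i\leqslant j$. For any $n,k\in\mathbb{N}$ with $2n+k\leqslant j$, there exists $K_{n,k}>0$ depending only on $\kappa_1,\kappa_2,(\lambda_i),\alpha,n,k$ such that the following holds. Let $f_0\in C^j(\mathbb{R},\mathbb{R})$ satisfy, for all $y\in\mathbb{R}$, $$\frac{\kappa_2}{(1+|y|)^{\alpha}}\geqslant f_0(y)\geqslant\frac{\kappa_1}{(1+|y|)^{\alpha}}$$ and, for every $i\in\mathbb{N}$ with $i\leqslant j$ and every $y\in\mathbb{R}$, $$|f_0^{(i)}(y)|\leqslant\frac{\lambda_i}{(1+|y|)^{\alpha+i}}.$$ Let $f$ be the solution of the viscous Burgers equation $\partial_t f-\partial_x^2 f+f\,\partial_x f=0$ on $\mathbb{R}$ with initial data $f_0$. Then for all $t\geqslant 0$, $$\|\partial_t^n\partial_x^k f(\cdot,t)\|_{L^\infty(\mathbb{R})}\leqslant\frac{K_{n,k}}{(1+t)^{\frac{\alpha}{1+\alpha}(1+2n+k)}}.$$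
   Context: The solution of the viscous Burgers equation with initial data $f_0$ is the one given by the Hopf-Cole formula: $f(\cdot,0)=f_0$ and, for $t>0$, $x\in\mathbb{R}$, $$f(x,t)=\frac{\int_{\mathbb{R}}\frac{x-y}{t}\exp\left(-\frac{(x-y)^2}{4t}-\frac12\int_0^y f_0(z)\,dz\right)dy}{\int_{\mathbb{R}}\exp\left(-\frac{(x-y)^2}{4t}-\frac12\int_0^y f_0(z)\,dz\right)dy}.$$ Here $\mathbb{N}$ includes $0$. *)

(* Defs.v *)
From HB Require Import structures.
From mathcomp Require Import all_boot all_order all_algebra.
From mathcomp Require Import all_classical all_reals all_analysis.

Set Implicit Arguments.
Unset Strict Implicit.
Unset Printing Implicit Defensive.

Import Order.TTheory GRing.Theory Num.Theory.
Import numFieldNormedType.Exports.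

Local Open Scope ring_scope.
Local Open Scope classical_set_scope.

Section Defs.
Context {R : realType}.
Implicit Types (f : R -> R -> R) (g : R -> R) (x y t : R).

(* Continuity of the derivatives of order < j follows from differentiability. *)
Definition is_Ck (j : nat) g : Prop :=
  (forall i : nat, (i < j)%N -> forall x, derivable (g^`(i)) x 1) /\
  continuous (g^`(j)).

(* The oriented integral of g from 0 to y. *)
Definition oint0 g y : R :=
  if 0 <= y then \int[lebesgue_measure]_(z in `[0, y]) g z
  else - \int[lebesgue_measure]_(z in `[y, 0]) g z.

Definition hopf_cole_weight (f0 : R -> R) x t y : R :=
  expR (- (x - y) ^+ 2 / (4 * t) - 2^-1 * oint0 f0 y).

(* The values at t < 0 are irrelevant: time derivatives below only look at
   the half-line [0, +oo[. *)
Definition burgers_solution (f0 : R -> R) x t : R :=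
  if 0 < t then
    (\int[lebesgue_measure]_y ((x - y) / t * hopf_cole_weight f0 x t y)) /
    (\int[lebesgue_measure]_y hopf_cole_weight f0 x t y)
  else f0 x.

(* Differentiation on the half-line [0, +oo[: two-sided for t > 0, and from
   the right at t = 0. *)
Definition time_quotient g t (s : R) : R := (g s - g t) / (s - t).

Definition time_derivable g t : Prop :=
  cvg (time_quotient g t @ within `[0, +oo[ t^').

Definition time_derive g t : R :=
  lim (time_quotient g t @ within `[0, +oo[ t^').

(* f is a function of (x, t); this is \partial_t^n \partial_x^k f. *)
Definition partial_tx (n k : nat) f x : R -> R :=
  iter n time_derive (fun t => (f^~ t)^`(k) x).

(* time_derive and derive1n are total functions, so the existence of the
   successive derivatives is recorded separately. *)
Definition has_partial_tx (n k : nat) f : Prop :=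
  (forall i : nat, (i < k)%N ->
     forall x t, 0 <= t -> derivable ((f^~ t)^`(i)) x 1) /\
  (forall i : nat, (i < n)%N ->
     forall x t, 0 <= t -> time_derivable (partial_tx i k f x) t).

End Defs.

(* Main.v *)
Require Import Defs.
From HB Require Import structures.
From mathcomp Require Import all_boot all_order all_algebra.
From mathcomp Require Import all_classical all_reals all_analysis.
From mathcomp Require Import measurable_realfun ess_sup_inf ring lra zify.

Set Implicit Arguments.
Unset Strict Implicit.
Unset Printing Implicit Defensive.

Import Order.TTheory GRing.Theory Num.Theory.
Import numFieldNormedType.Exports.

Local Open Scope ring_scope.
Local Open Scope classical_set_scope.

(** Put [F y] for the primitive of [f0] vanishing at 0 and [v0 = exp (- F / 2)].
    The Hopf-Cole formula says that [f = - 2 v_x / v], where [v] solves the heat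
    equation with initial data [v0].  Integrating the numerator by parts removes
    the factor [(x - y) / t], and the substitution [y = x + sqrt t * z] turns
    [v] and its derivatives into integrals
    [heat g x s = \int exp (- z^2 / 4) * g (x + s * z) dz] taken at
    [s = sqrt t], which make sense up to [t = 0]
    ([burgers_solutionE], [is_derive_heat_x], [is_derive_heat_t]).

    Write [V i] for the heat extension of the [i]-th derivative of [v0] and
    [U i = V (i + 1) / V 0].  Then
    [d_x (U i) = U (i + 1) - U i * U 0] and
    [d_t (U i) = U (i + 2) - U i * U 1],
    so that [d_t^n d_x^k f] is a polynomial in the [U i]; it is homogeneous of
    weight [1 + 2 n + k] when [U i] has weight [i + 1].  Everything reduces to
    the bound [|V i| <= C * (1 + t) ^ (- alpha * i / (1 + alpha)) * V 0].

    In the same way the [i]-th derivative of [v0] is [v0] times a polynomial of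
    weight [i] in the derivatives of [f0], and it is bounded by
    [C * v0 * h ^ i] with [h y = (1 + |y|) ^ (- alpha)].  So the claim is that the
    probability measure with density proportional to
    [exp (- (x - y)^2 / (4 t) - F y / 2)] gives [h ^ i] a mean of order at most
    [L ^ (- alpha * i)] at the length scale [L = (1 + t) ^ (1 / (1 + alpha))],
    uniformly in [x].  This holds because the measure avoids [|y| <= delta * L]
    ([energy_drop]).  Let [Q] be minus the exponent of the density, and compare
    its value at such a [y] with those at [y - delta * L] and [y + L], weighted so
    that the terms containing [x] cancel.  On the left [F] drops at least at the rate
    [kappa1 * (1 + 2 * delta * L) ^ (- alpha)], which for small [delta] dominates
    both the growth of [F] on the right and the convexity of the quadratic term.
    Hence one of the two values of [Q] is smaller by at least
    [delta * L ^ (1 - alpha)], and the density at [y] is exponentially small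
    compared with one of its two translates.  Integrating this pointwise inequality
    ([gauss_cole_concentration]) gives the bound on [V i]
    ([heat_cole_derive_decay]). *)

(** * Homogeneous polynomials with derivations *)

Section DiffPoly.
Context {R : realType}.

(** The variable [DVar i] carries the weight [i.+1], like the [i]-th derivative
    of a quantity of weight 1.  The same syntax serves for the derivatives of the
    initial data and for those of the solution; being syntax, it provides
    constants that are chosen before the functions are. *)
Inductive dpoly : Type :=
| DVar of nat
| DCst of R
| DAdd of dpoly & dpoly
| DMul of dpoly & dpoly.

Fixpoint deval (X : nat -> R) (p : dpoly) : R :=
  match p with
  | DVar i => X i
  | DCst c => c
  | DAdd p q => deval X p + deval X q
  | DMul p q => deval X p * deval X q
  end.

Fixpoint dderive (d : nat -> dpoly) (p : dpoly) : dpoly :=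
  match p with
  | DVar i => d i
  | DCst _ => DCst 0
  | DAdd p q => DAdd (dderive d p) (dderive d q)
  | DMul p q => DAdd (DMul (dderive d p) q) (DMul p (dderive d q))
  end.

(** The constant 0 is homogeneous of every weight, since it arises as the
    derivative of a constant. *)
Fixpoint homog (w : nat) (p : dpoly) : Prop :=
  match p with
  | DVar i => w = i.+1
  | DCst c => w = 0%N \/ c = 0
  | DAdd p q => homog w p /\ homog w q
  | DMul p q => exists2 uv : nat * nat, w = (uv.1 + uv.2)%N &
                  homog uv.1 p /\ homog uv.2 q
  end.

Lemma homog_dderive r d : (forall i, homog (i.+1 + r) (d i)) ->
  forall p w, homog w p -> homog (w + r) (dderive d p).
Proof.
move=> dh; elim=> [i|c|p IHp q IHq|p IHp q IHq] w /=.
- by move=> ->.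
- by right.
- by move=> [/IHp ? /IHq].
- move=> [[u v] /= -> [hp hq]]; split.
  + by exists ((u + r)%N, v) => /=; [rewrite addnAC|split => //; exact: IHp].
  + by exists (u, (v + r)%N) => /=; [rewrite addnA|split => //; exact: IHq].
Qed.

(** The constant depends on the polynomial and on the [c i] only; the uniformity
    of the final estimate in the initial data rests on this. *)
Lemma deval_bounded (c : nat -> R) p w : homog w p -> (forall i, 0 <= c i) ->
  exists2 C : R, 0 <= C & forall (X : nat -> R) (rho : R), 0 <= rho ->
    (forall i, (i < w)%N -> `|X i| <= c i * rho ^+ i.+1) ->
    `|deval X p| <= C * rho ^+ w.
Proof.
move=> + c0; elim: p w => [i|a|p IHp q IHq|p IHp q IHq] w /=.
- by move=> ->; exists (c i) => // X rho rho0; apply.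
- move=> [->|->]; first by exists `|a| => // X rho _ _; rewrite expr0 mulr1.
  by exists 0 => // X rho _ _; rewrite normr0 mul0r.
- move=> [/IHp[C C0 pC] /IHq[D D0 qD]].
  exists (C + D); first exact: addr_ge0.
  move=> X rho rho0 Xc; rewrite mulrDl (le_trans (ler_normD _ _))// lerD//.
    exact: pC.
  exact: qD.
- move=> [[u v] /= -> [/IHp[C C0 pC] /IHq[D D0 qD]]].
  exists (C * D); first exact: mulr_ge0.
  move=> X rho rho0 Xc; rewrite normrM exprD mulrACA ler_pM//.
    by apply: pC => // i iu; apply: Xc; rewrite (leq_trans iu)// leq_addr.
  by apply: qD => // i iv; apply: Xc; rewrite (leq_trans iv)// leq_addl.
Qed.

(** A polynomial of weight [w] involves only variables of index less than [w],
    because all weights are positive: a single count keeps track both of the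
    decay and of the regularity that is used. *)
Lemma is_derive_deval (X : nat -> R -> R) (d : nat -> dpoly) (y : R) p w :
  homog w p ->
  (forall i, (i < w)%N -> is_derive y 1 (X i) (deval (X ^~ y) (d i))) ->
  is_derive y 1 (fun z => deval (X ^~ z) p) (deval (X ^~ y) (dderive d p)).
Proof.
elim: p w => [i|a|p IHp q IHq|p IHp q IHq] w /=.
- by move=> -> ; apply.
- by move=> _ _; exact: is_derive_cst.
- move=> [hp hq] Xd.
  exact: (is_deriveD (IHp _ hp Xd) (IHq _ hq Xd)).
- move=> [[u v] /= -> [hp hq]] Xd.
  have dp := IHp _ hp (fun i iu => Xd i (leq_trans iu (leq_addr _ _))).
  have dq := IHq _ hq (fun i iv => Xd i (leq_trans iv (leq_addl _ _))).
  apply: is_derive_eq (is_deriveM dp dq) _.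
  by rewrite /GRing.scale/= addrC [deval _ q * _]mulrC.
Qed.

Lemma continuous_deval (T : topologicalType) (X : nat -> T -> R) p w :
  homog w p -> (forall i, (i < w)%N -> continuous (X i)) ->
  continuous (fun z => deval (X ^~ z) p).
Proof.
elim: p w => [i|a|p IHp q IHq|p IHp q IHq] w /=.
- by move=> -> ; apply.
- by move=> _ _ z; exact: cvg_cst.
- by move=> [hp hq] Xd z; apply: cvgD; [exact: (IHp _ hp Xd)|exact: (IHq _ hq Xd)].
- move=> [[u v] /= -> [hp hq]] Xd z; apply: cvgM.
    exact: (IHp _ hp (fun i iu => Xd i (leq_trans iu (leq_addr _ _)))).
  exact: (IHq _ hq (fun i iv => Xd i (leq_trans iv (leq_addl _ _)))).
Qed.

End DiffPoly.
Arguments dpoly : clear implicits.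

(** * Integrals dominated by an exponential *)
Section Domination.
Context {R : realType}.
Local Notation mu := (@lebesgue_measure R).
Implicit Types (f g : R -> R) (x y z a b c : R).

Lemma continuous_expR_norm : continuous (fun z : R => expR (- `|z|)).
Proof.
move=> z; apply: continuous_comp; last exact: continuous_expR.
by apply: continuousN; exact: norm_continuous.
Qed.

Lemma integrable_expR_norm :
  mu.-integrable [set: R] (EFin \o (fun z : R => expR (- `|z|))).
Proof.
have mf : measurable_fun [set: R] (fun z : R => expR (- `|z|)).
  exact: continuous_measurable_fun continuous_expR_norm.
apply/integrableP; split; first exact/measurable_EFinP.
under eq_integral do rewrite /= ger0_norm ?expR_ge0//.
rewrite ge0_symfun_integralT.
- rewrite -set_itvcy (_ : (\int[mu]_(x in `[0%R, +oo[) _ = 1)%E)//; last first.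
    rewrite (_ : 1%E = (0%:E - (- expR (- 0))%:E)%E); last first.
      by rewrite oppr0 expR0 -EFinB sub0r opprK.
    under eq_integral => x.
      rewrite inE/= in_itv/= andbT => x0; rewrite ger0_norm//.
      over.
    apply: (@ge0_continuous_FTC2y _ (fun x => expR (- x)) (fun x => - expR (- x)) 0 0).
    + by move=> *; exact: expR_ge0.
    + apply: continuous_subspaceT => x.
      by apply: continuous_comp; [exact: opp_continuous|exact: continuous_expR].
    + by rewrite -(@oppr0 R); apply: cvgN; exact: cvgr_expR.
    + by move=> x _; exact: ex_derive.
    + apply/cvg_at_right_filter; apply: cvgN.
      by apply: continuous_comp; [exact: opp_continuous|exact: continuous_expR].
    + move=> x _; rewrite derive1E; apply: derive_val.
      by apply: is_derive_eq; rewrite mulrN1 opprK.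
  by rewrite mule1 ltry.
- by move=> *; exact: expR_ge0.
- exact: continuous_expR_norm.
- by move=> x /=; rewrite normrN.
Qed.

(** The majorant [expR (- `|z|)] absorbs a Gaussian times any exponential, and
    a translation changes it only by a constant factor. *)
Definition exp_dominated f : Prop :=
  exists C : R, forall z, `|f z| <= C * expR (- `|z|).

Lemma exp_dominated_integrable f : continuous f -> exp_dominated f ->
  mu.-integrable [set: R] (EFin \o f).
Proof.
move=> cf [C fC].
apply: (@le_integrable _ _ _ mu _ measurableT _
   (EFin \o (fun z : R => C * expR (- `|z|)))).
- by apply/measurable_EFinP; exact: continuous_measurable_fun.
- move=> z _ /=; rewrite lee_fin (le_trans (fC z))// ler_norm//.
- by rewrite /comp; under eq_fun do rewrite EFinM; apply: integrableZl => //;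
   exact: integrable_expR_norm.
Qed.

Lemma exp_dominatedW f g : (forall z, `|f z| <= `|g z|) ->
  exp_dominated g -> exp_dominated f.
Proof. by move=> fg [C gC]; exists C => z; exact: le_trans (gC z). Qed.

Lemma exp_dominatedD f g : exp_dominated f -> exp_dominated g ->
  exp_dominated (fun z => f z + g z).
Proof.
move=> [C fC] [D gD]; exists (C + D) => z.
by rewrite mulrDl (le_trans (ler_normD _ _))// lerD.
Qed.

Lemma exp_dominatedZ c f : exp_dominated f -> exp_dominated (fun z => c * f z).
Proof.
move=> [C fC]; exists (`|c| * C) => z.
by rewrite normrM -mulrA ler_wpM2l.
Qed.

Lemma exp_dominated_shift h f : exp_dominated f ->
  exp_dominated (fun z => f (h + z)).
Proof.
move=> [C fC]; exists (C * expR `|h|) => z.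
have C0 : 0 <= C.
  by have := le_trans (normr_ge0 _) (fC 0); rewrite pmulr_lge0// expR_gt0.
rewrite (le_trans (fC _))// -mulrA ler_wpM2l// -expRD ler_expR.
have := ler_normB (h + z) h; rewrite addrAC subrr add0r; lra.
Qed.

Lemma is_derive_dominated (f df : R -> R -> R) a C :
  (forall l, continuous (f l)) ->
  (forall l z, `|l - a| < 1 -> is_derive l 1 (f ^~ z) (df l z)) ->
  (forall l z, `|l - a| < 1 -> `|f l z| <= C * expR (- `|z|)) ->
  (forall l z, `|l - a| < 1 -> `|df l z| <= C * expR (- `|z|)) ->
  is_derive a 1 (fun l => \int[mu]_z f l z) (\int[mu]_z df a z).
Proof.
move=> cf dfE fC dfC.
have near1 l : (`]a - 1, a + 1[%classic : set R) l -> `|l - a| < 1.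
  by rewrite /= in_itv/= => /andP[? ?]; rewrite ltr_norml; lra.
have Ia : (`]a - 1, a + 1[%classic : set R) a by rewrite /= in_itv/=; lra.
have d1E l z : `|l - a| < 1 -> partial1of2 f l z = df l z.
  move=> la; rewrite partial1of2E.
  exact: (@derive_val _ _ _ _ _ _ _ (dfE l z la)).
have C0 : 0 <= C.
  have := fC a 0; rewrite subrr normr0 => /(_ ltr01) /(le_trans (normr_ge0 _)).
  by rewrite pmulr_lge0// expR_gt0.
pose G z := C * expR (- `|z|).
have cG : continuous G.
  by move=> z; apply: cvgMr; exact: continuous_expR_norm.
have iG : mu.-integrable [set: R] (EFin \o G).
  apply: exp_dominated_integrable cG _.
  by exists C => z; rewrite ger0_norm// mulr_ge0 ?expR_ge0.
have intf l : (`]a - 1, a + 1[%classic : set R) l ->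
    mu.-integrable [set: R] (EFin \o f l).
  move=> /near1 la; apply: exp_dominated_integrable; first exact: cf.
  by exists C => z; exact: fC.
have derf l z : (`]a - 1, a + 1[%classic : set R) l -> [set: R] z ->
    derivable (f ^~ z) l 1.
  by move=> /near1 la _; have [] := dfE l z la.
have G0 z : 0 <= G z by rewrite mulr_ge0 ?expR_ge0.
have Gub l z : (`]a - 1, a + 1[%classic : set R) l -> [set: R] z ->
    `|partial1of2 f l z| <= G z.
  by move=> /near1 la _; rewrite d1E//; exact: dfC.
apply: DeriveDef.
  exact: (derivable_under_integral measurableT Ia intf derf G0 iG Gub).
rewrite -derive1E (differentiation_under_integral measurableT Ia intf derf G0 iG Gub).
by apply: eq_Rintegral => z _; rewrite d1E// subrr normr0.
Qed.

Lemma continuous_dominated (f : R -> R -> R) a C :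
  (forall l, continuous (f l)) ->
  (forall z, continuous (f ^~ z)) ->
  (forall l z, `|l - a| < 1 -> `|f l z| <= C * expR (- `|z|)) ->
  {for a, continuous (fun l => \int[mu]_z f l z)}.
Proof.
move=> cf cfz fC.
have near1 l : (`]a - 1, a + 1[%classic : set R) l -> `|l - a| < 1.
  by rewrite /= in_itv/= => /andP[? ?]; rewrite ltr_norml; lra.
have Ia : a \in (`]a - 1, a + 1[%classic : set R).
  by rewrite inE /= in_itv/=; lra.
have C0 : 0 <= C.
  have := fC a 0; rewrite subrr normr0 => /(_ ltr01) /(le_trans (normr_ge0 _)).
  by rewrite pmulr_lge0// expR_gt0.
pose G z := C * expR (- `|z|).
have cG : continuous G.
  by move=> z; apply: cvgMr; exact: continuous_expR_norm.
have iG : mu.-integrable [set: R] (EFin \o G).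
  apply: exp_dominated_integrable cG _.
  by exists C => z; rewrite ger0_norm// mulr_ge0 ?expR_ge0.
apply: (@continuity_under_integral _ _ _ mu f setT measurableT
  (a - 1) (a + 1) _ _ G) => //.
- move=> l /near1 la; apply: exp_dominated_integrable; first exact: cf.
  by exists C => z; exact: fC.
- by apply: aeW => z _ l _; exact: cfz.
- by move=> l /near1 la; apply: aeW => z _; exact: fC.
Qed.

Lemma ge0_integral_affine c d f : 0 < c -> continuous f -> (forall z, 0 <= f z) ->
  (\int[mu]_y (f y)%:E = \int[mu]_z (f (d + c * z) * c)%:E)%E.
Proof.
move=> c0 cf f0.
have dF z : is_derive z 1 (fun z => d + c * z) c.
  by apply: is_derive_eq; rewrite add0r mul1r [_%:A]mulr1.
have dFE : (fun z => d + c * z)^`() = cst c.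
  by apply/funext => z; rewrite derive1E; exact: derive_val.
rewrite (@increasing_ge0_integration_by_substitutionT _ (fun z => d + c * z) f)//.
- by apply: eq_integral => z _; rewrite /= !fctE dFE.
- by move=> x y xy; rewrite ltrD2l ltr_pM2l.
- by rewrite dFE; exact: cst_continuous.
- by rewrite dFE; apply: (cvgP c); exact: cvg_cst.
- by rewrite dFE; apply: (cvgP c); exact: cvg_cst.
- apply: (@cvg_comp _ _ _ (fun z : R => c * z) (fun z => d + z)
    _ _ _ _ (cvg_addrl_Ny d)).
  by under eq_fun do rewrite mulrC; apply: gt0_cvgMlNy c0 cvg_id.
- apply: (@cvg_comp _ _ _ (fun z : R => c * z) (fun z => d + z) _ _ _ _ (cvg_addrl d)).
  by apply: gt0_cvgMry c0 cvg_id.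
Qed.

Lemma continuous_affine c d f : continuous f -> continuous (fun z => f (d + c * z)).
Proof.
move=> cf z; apply: (@continuous_comp _ _ _ (fun z => d + c * z)); last exact: cf.
by apply: cvgD; [exact: cvg_cst|apply: cvgMr; exact: cvg_id].
Qed.

Lemma integrable_affine c d f : 0 < c -> continuous f ->
  exp_dominated (fun z => f (d + c * z)) -> mu.-integrable [set: R] (EFin \o f).
Proof.
move=> c0 cf df.
have cg := @continuous_affine c d _ cf.
apply/integrableP; split.
  by apply/measurable_EFinP; exact: continuous_measurable_fun.
rewrite [ltLHS](_ : _ = (\int[mu]_y (`|f y|)%:E)%E)//.
rewrite (@ge0_integral_affine c d)//; last first.
  by move=> z; apply: (@continuous_comp _ _ _ f); [exact: cf|exact: norm_continuous].
have := integrableZr measurableT c (exp_dominated_integrable cg df).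
move=> /integrableP[_]; congr (_ < _)%E.
by apply: eq_integral => z _; rewrite /= normrM (gtr0_norm c0).
Qed.

Lemma Rintegral_affine c d f : 0 < c -> continuous f ->
  exp_dominated (fun z => f (d + c * z)) ->
  \int[mu]_y f y = c * \int[mu]_z f (d + c * z).
Proof.
move=> c0 cf df.
have ge0_case g : continuous g -> exp_dominated (fun z => g (d + c * z)) ->
    (forall z, 0 <= g z) -> \int[mu]_y g y = c * \int[mu]_z g (d + c * z).
  move=> cg dg g0; rewrite -RintegralZl//.
    rewrite /Rintegral (ge0_integral_affine d c0)//; congr fine.
    by apply: eq_integral => z _; rewrite mulrC.
  by apply: exp_dominated_integrable dg; exact: continuous_affine.
have cn : continuous (fun z => `|f z|).
  by move=> z; apply: (@continuous_comp _ _ _ f); [exact: cf|exact: norm_continuous].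
have dn : exp_dominated (fun z => `|f (d + c * z)|).
  by apply: exp_dominatedW df => z; rewrite normr_id.
have cp : continuous (fun z => `|f z| + f z).
  by move=> z; apply: cvgD; [exact: cn|exact: cf].
have dp : exp_dominated (fun z => `|f (d + c * z)| + f (d + c * z)).
  exact: exp_dominatedD.
(* Both terms of this difference are nonnegative and continuous. *)
have fE z : f z = (`|f z| + f z) - `|f z| by rewrite addrAC subrr add0r.
have intB g1 g2 : mu.-integrable [set: R] (EFin \o g1) ->
    mu.-integrable [set: R] (EFin \o g2) ->
    \int[mu]_z (g1 z - g2 z) = \int[mu]_z g1 z - \int[mu]_z g2 z.
  by move=> i1 i2; rewrite RintegralB.
under eq_Rintegral do rewrite fE.
under [in RHS]eq_Rintegral do rewrite fE.
rewrite intB; last 2 first.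
- exact: (integrable_affine c0 cp dp).
- exact: (integrable_affine c0 cn dn).
rewrite intB; last 2 first.
- exact: (exp_dominated_integrable (@continuous_affine c d _ cp) dp).
- exact: (exp_dominated_integrable (@continuous_affine c d _ cn) dn).
rewrite mulrBr (ge0_case _ cp)//; last first.
  by move=> z; rewrite -lerBlDr sub0r ler_normr lexx orbT.
by rewrite (ge0_case _ cn).
Qed.

Lemma Rintegral_shift h f : continuous f -> exp_dominated f ->
  \int[mu]_z f (h + z) = \int[mu]_z f z.
Proof.
move=> cf df; rewrite [RHS](@Rintegral_affine 1 h)//; last first.
  under eq_fun do rewrite mul1r; exact: exp_dominated_shift.
by rewrite mul1r; apply: eq_Rintegral => z _; rewrite mul1r.
Qed.

(** The integral of [z |-> g (h + z)] does not depend on [h], and its derivative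
    at [h = 0] is the integral of [dg]. *)
Lemma Rintegral_derive0 (g dg : R -> R) :
  (forall z, is_derive z 1 g (dg z)) -> continuous dg ->
  exp_dominated g -> exp_dominated dg -> \int[mu]_z dg z = 0.
Proof.
move=> gE cdg dog dodg.
have cg : continuous g.
  by move=> z; apply/differentiable_continuous/derivable1_diffP; have [] := gE z.
have [C1 gC] := dog; have [C2 dgC] := dodg.
pose C := (`|C1| + `|C2|) * expR 1.
have dom f D l z : (D <= `|C1| + `|C2|) ->
    (forall z, `|f z| <= D * expR (- `|z|)) ->
    `|l - 0| < 1 -> `|f (l + z)| <= C * expR (- `|z|).
  rewrite subr0 => DC fD l1; rewrite (le_trans (fD _))//.
  have D0 : 0 <= `|C1| + `|C2| by rewrite addr_ge0.
  rewrite (le_trans (ler_wpM2r (expR_ge0 _) DC))// /C -mulrA ler_wpM2l//.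
  rewrite -expRD ler_expR.
  have := ler_normB (l + z) l; rewrite addrAC subrr add0r; lra.
have D := @is_derive_dominated (fun l z => g (l + z)) (fun l z => dg (l + z)) 0 C.
have {D} : is_derive (0:R) 1 (fun l => \int[mu]_z g (l + z)) (\int[mu]_z dg (0 + z)).
  apply: D.
  - by move=> l; under eq_fun do rewrite -[X in _ + X]mul1r; exact: continuous_affine.
  - move=> l z _.
    have := @is_derive1_comp _ g (shift z) l _ _ (gE (l + z))
      (is_derive_shift l 1 z).
    by rewrite mulr1.
  - by move=> l z; apply: dom gC; rewrite (le_trans (ler_norm _))// lerDl.
  - by move=> l z; apply: dom dgC; rewrite (le_trans (ler_norm _))// lerDr.
under eq_fun do rewrite Rintegral_shift//.
rewrite (Rintegral_shift 0)// => H; have := @derive_val _ _ _ _ _ _ _ H.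
by rewrite derive_cst.
Qed.

End Domination.

(** * The heat extension of a function *)
Section Heat.
Context {R : realType}.
Local Notation mu := (@lebesgue_measure R).
Implicit Types (f g : R -> R) (x y z s t : R).

Definition gauss z : R := expR (- z ^+ 2 / 4).

Definition exp_growth g : Prop :=
  exists A B : R, [/\ 0 <= A, 0 <= B & forall y, `|g y| <= A * expR (B * `|y|)].

(** Up to a constant factor, the solution at the point [x] and at the time
    [s ^+ 2] of the heat equation with initial data [g]. *)
Definition heat g x s : R := \int[mu]_z (gauss z * g (x + s * z)).

Lemma gauss_gt0 z : 0 < gauss z. Proof. exact: expR_gt0. Qed.

Lemma is_derive_gauss z : is_derive z 1 gauss (- (z / 2) * gauss z).
Proof.
have D : is_derive z 1 (fun z => - z ^+ 2 / 4) (- (z / 2)).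
  have -> : (fun z => - z ^+ 2 / 4) = (fun z => (- 4^-1) * (z * z)).
    by apply/funext => y; field.
  have := is_deriveZ (- 4^-1) (is_deriveM (is_derive_id z 1) (is_derive_id z 1)).
  by move/is_derive_eq; apply; rewrite /GRing.scale/=; field.
have := @is_derive1_comp _ expR _ z _ _ (is_derive_expR _) D.
by rewrite mulrC.
Qed.

Lemma continuous_gauss : continuous gauss.
Proof.
move=> z; apply/differentiable_continuous/derivable1_diffP.
by have [] := is_derive_gauss z.
Qed.

(** The constant comes from completing the square in
    [- z ^+ 2 / 4 + (b + 2) * `|z|]. *)
Lemma gauss_decay b z : gauss z * ((1 + `|z|) * expR (b * `|z|)) <=
  expR ((b + 2) ^+ 2) * expR (- `|z|).
Proof.
rewrite (@le_trans _ _ (gauss z * (expR `|z| * expR (b * `|z|))))//.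
  by rewrite ler_wpM2l ?(ltW (gauss_gt0 _))// ler_wpM2r ?expR_ge0// expR_ge1Dx.
rewrite /gauss -!expRD ler_expR -real_normK ?num_real//.
have := sqr_ge0 (`|z| / 2 - (b + 2)); lra.
Qed.

Lemma gauss_growth A B X S g x s z : 0 <= A -> 0 <= B ->
  (forall y, `|g y| <= A * expR (B * `|y|)) -> `|x| <= X -> `|s| <= S ->
  (1 + `|z|) * (gauss z * `|g (x + s * z)|) <=
  A * expR (B * X) * expR ((B * S + 2) ^+ 2) * expR (- `|z|).
Proof.
move=> A0 B0 gAB xX sS.
apply: (@le_trans _ _ ((1 + `|z|) *
    (gauss z * (A * (expR (B * X) * expR (B * S * `|z|)))))).
  rewrite ler_wpM2l ?addr_ge0// ler_wpM2l ?(ltW (gauss_gt0 _))//.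
  rewrite (le_trans (gAB _))// ler_wpM2l// -expRD ler_expR -mulrA -mulrDr ler_wpM2l//.
  by rewrite (le_trans (ler_normD _ _))// lerD// normrM ler_wpM2r.
rewrite [leLHS](_ : _ = A * expR (B * X) *
  (gauss z * ((1 + `|z|) * expR (B * S * `|z|)))); last by ring.
rewrite -[leRHS]mulrA; apply: ler_wpM2l (gauss_decay _ _).
by rewrite mulr_ge0 ?expR_ge0.
Qed.

Lemma gauss_growth_dominated g x s : exp_growth g ->
  exp_dominated (fun z => (1 + `|z|) * (gauss z * g (x + s * z))).
Proof.
move=> [A [B [A0 B0 gAB]]].
exists (A * expR (B * `|x|) * expR ((B * `|s| + 2) ^+ 2)) => z.
rewrite !normrM (ger0_norm (ltW (gauss_gt0 z))) [X in X * _]ger0_norm ?addr_ge0//.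
exact: gauss_growth.
Qed.

Lemma heat_dominated g x s : exp_growth g ->
  exp_dominated (fun z => gauss z * g (x + s * z)).
Proof.
move=> /(gauss_growth_dominated x s); apply: exp_dominatedW => z.
by rewrite [leRHS]normrM ler_peMl// ger0_norm ?addr_ge0// lerDl.
Qed.

Lemma heat_moment_dominated g x s : exp_growth g ->
  exp_dominated (fun z => z * (gauss z * g (x + s * z))).
Proof.
move=> /(gauss_growth_dominated x s); apply: exp_dominatedW => z.
by rewrite !normrM ler_wpM2r// [leRHS]ger0_norm ?addr_ge0// lerDr.
Qed.

Lemma continuous_heat_integrand g x s : continuous g ->
  continuous (fun z => gauss z * g (x + s * z)).
Proof.
move=> cg z; apply: cvgM; first exact: continuous_gauss.
exact: (@continuous_affine _ s x g cg z).
Qed.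

Lemma heat_integrable g x s : continuous g -> exp_growth g ->
  mu.-integrable [set: R] (EFin \o (fun z => gauss z * g (x + s * z))).
Proof.
move=> cg gg; apply: exp_dominated_integrable; first exact: continuous_heat_integrand.
exact: heat_dominated.
Qed.

Lemma near_norm_le x y : `|y - x| < 1 -> `|y| <= `|x| + 1.
Proof. by move=> ?; have := ler_normD x (y - x); rewrite addrC subrK; lra. Qed.

Lemma continuous_heat g x : continuous g -> exp_growth g -> continuous (heat g x).
Proof.
move=> cg [A [B [A0 B0 gAB]]] s.
apply: (@continuous_dominated _ (fun s z => gauss z * g (x + s * z)) s
  (A * expR (B * `|x|) * expR ((B * (`|s| + 1) + 2) ^+ 2))).
- by move=> l; exact: continuous_heat_integrand.
- move=> z; have cz : continuous (fun l : R => g (x + l * z)).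
    rewrite (_ : (fun l : R => g (x + l * z)) = (fun l => g (x + z * l))).
      exact: continuous_affine.
    by apply/funext => k; rewrite mulrC.
  by move=> l; apply: cvgMr; exact: cz.
- move=> l z ls; apply: le_trans (gauss_growth z A0 B0 gAB (lexx _) (near_norm_le ls)).
  rewrite normrM (ger0_norm (ltW (gauss_gt0 z))).
  by rewrite ler_peMl ?mulr_ge0 ?(ltW (gauss_gt0 z))// lerDl.
Qed.

Lemma is_derive_continuous g dg : (forall y, is_derive y 1 g (dg y)) -> continuous g.
Proof.
by move=> gE y; apply/differentiable_continuous/derivable1_diffP; have [] := gE y.
Qed.

Lemma is_derive_quotient f g y df dg : g y != 0 ->
  is_derive y 1 f df -> is_derive y 1 g dg ->
  is_derive y 1 (fun z => f z / g z) (df / g y + -1 * (f y / g y * (dg / g y))).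
Proof.
move=> gy0 fE gE; have := is_deriveM fE (is_deriveV gy0 gE).
by move/is_derive_eq; apply; rewrite /GRing.scale/=; field.
Qed.

Lemma is_derive_affine_comp g dg c d y : is_derive (d + y * c) 1 g dg ->
  is_derive y 1 (fun y => g (d + y * c)) (dg * c).
Proof.
move=> gE; have D : is_derive y 1 (fun y => d + y * c) c.
  have := is_deriveD (is_derive_cst d y 1)
    (is_deriveM (is_derive_id y 1) (is_derive_cst c y 1)).
  by move/is_derive_eq; apply; rewrite /GRing.scale/= mulr0 mulr1 !add0r.
exact: (@is_derive1_comp _ g _ y _ _ gE D).
Qed.

Lemma is_derive_heat_x g dg x s : (forall y, is_derive y 1 g (dg y)) ->
  continuous dg -> exp_growth g -> exp_growth dg ->
  is_derive x 1 (heat g ^~ s) (heat dg x s).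
Proof.
move=> gE cdg [A [B [A0 B0 gAB]]] [A' [B' [A'0 B'0 gAB']]].
have cg := is_derive_continuous gE.
pose C A B : R := A * expR (B * (`|x| + 1)) * expR ((B * `|s| + 2) ^+ 2).
have C0 A1 B1 : 0 <= A1 -> 0 <= C A1 B1 by move=> ?; rewrite !mulr_ge0 ?expR_ge0.
have dom h A1 B1 A2 B2 l z : 0 <= A1 -> 0 <= B1 -> 0 <= A2 ->
    (forall y, `|h y| <= A1 * expR (B1 * `|y|)) -> `|l - x| < 1 ->
    `|gauss z * h (l + s * z)| <= (C A1 B1 + C A2 B2) * expR (- `|z|).
  move=> A10 B10 A20 hAB lx; rewrite (@le_trans _ _ (C A1 B1 * expR (- `|z|)))//.
    apply: le_trans (gauss_growth z A10 B10 hAB (near_norm_le lx) (lexx _)).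
    rewrite normrM (ger0_norm (ltW (gauss_gt0 z))).
    by rewrite ler_peMl ?mulr_ge0 ?(ltW (gauss_gt0 z))// lerDl.
  by rewrite ler_wpM2r ?expR_ge0// lerDl C0.
apply: (@is_derive_dominated _ (fun l z => gauss z * g (l + s * z))
  (fun l z => gauss z * dg (l + s * z)) x (C A B + C A' B')).
- by move=> l; exact: continuous_heat_integrand.
- move=> l z _; apply: is_deriveZ.
  have := @is_derive_affine_comp g (dg (l + s * z)) 1 (s * z) l.
  rewrite mulr1 addrC => /(_ (gE _)); rewrite mulr1.
  by under eq_fun do rewrite mulr1 addrC.
- by move=> l z; exact: dom.
- by move=> l z; rewrite [C A B + _]addrC; exact: dom.
Qed.

(** Integration by parts, as [z * gauss z] is [- 2] times the derivative of
    [gauss]. *)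
Lemma heat_moment g dg x s : (forall y, is_derive y 1 g (dg y)) ->
  continuous dg -> exp_growth g -> exp_growth dg ->
  \int[mu]_z (z * (gauss z * g (x + s * z))) = 2 * s * heat dg x s.
Proof.
move=> gE cdg gg gdg; have cg := is_derive_continuous gE.
pose G z := gauss z * g (x + s * z).
have GE z : is_derive z 1 G (s * (gauss z * dg (x + s * z)) - 2^-1 * (z * G z)).
  have D := @is_derive_affine_comp g (dg (x + z * s)) s x z (gE _).
  have := is_deriveM (is_derive_gauss z) D.
  rewrite (_ : gauss * (fun y => g (x + y * s)) = G); last first.
    by apply/funext => y; rewrite /G [s * y]mulrC.
  by move/is_derive_eq; apply; rewrite /G /GRing.scale/= [z * s]mulrC; field.
have cdG : continuous (fun z => s * (gauss z * dg (x + s * z))).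
  by move=> z; apply: cvgMr; exact: continuous_heat_integrand.
have czG : continuous (fun z => 2^-1 * (z * G z)).
  move=> z; apply: cvgMr; apply: cvgM; first exact: cvg_id.
  exact: continuous_heat_integrand.
have ddG : exp_dominated (fun z => s * (gauss z * dg (x + s * z))).
  by apply: exp_dominatedZ; exact: heat_dominated.
have dzG : exp_dominated (fun z => 2^-1 * (z * G z)).
  by apply: exp_dominatedZ; exact: heat_moment_dominated.
have idG := heat_integrable x s cdg gdg.
have izG : mu.-integrable [set: R] (EFin \o (fun z => z * G z)).
  apply: exp_dominated_integrable; last exact: heat_moment_dominated.
  move=> z; apply: cvgM; first exact: cvg_id.
  exact: continuous_heat_integrand.
have H0 : \int[mu]_z (s * (gauss z * dg (x + s * z)) - 2^-1 * (z * G z)) = 0.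
  apply: (Rintegral_derive0 GE).
  - by move=> z; apply: cvgB; [exact: cdG|exact: czG].
  - exact: heat_dominated.
  - apply: exp_dominatedD => //.
    by apply: exp_dominatedW dzG => z; rewrite normrN.
move: H0; rewrite RintegralB//; last 2 first.
- exact: exp_dominated_integrable.
- exact: exp_dominated_integrable.
rewrite RintegralZl// RintegralZl// -/(heat dg x s) => /eqP.
by rewrite subr_eq0 => /eqP E; rewrite -mulrA E mulrA divff// mul1r.
Qed.

(** Differentiating in [s] brings down a factor [z], which [heat_moment] trades
    for a second derivative and a factor [2 * s]. *)
Lemma is_derive_heat_s g dg ddg x s : (forall y, is_derive y 1 g (dg y)) ->
  (forall y, is_derive y 1 dg (ddg y)) ->
  continuous ddg -> exp_growth g -> exp_growth dg -> exp_growth ddg ->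
  is_derive s 1 (heat g x) (2 * s * heat ddg x s).
Proof.
move=> gE dgE cddg [A [B [A0 B0 gAB]]] gdg gddg.
rewrite -(heat_moment x s dgE cddg gdg gddg).
move: gdg => [A' [B' [A'0 B'0 gAB']]].
have cg := is_derive_continuous gE.
have cdg := is_derive_continuous dgE.
pose C A B : R := A * expR (B * `|x|) * expR ((B * (`|s| + 1) + 2) ^+ 2).
have C0 A1 B1 : 0 <= A1 -> 0 <= C A1 B1 by move=> ?; rewrite !mulr_ge0 ?expR_ge0.
have dom h A1 B1 A2 B2 l z k : 0 <= A1 -> 0 <= B1 -> 0 <= A2 ->
    (forall y, `|h y| <= A1 * expR (B1 * `|y|)) -> `|k| <= 1 + `|z| -> `|l - s| < 1 ->
    `|k * (gauss z * h (x + l * z))| <= (C A1 B1 + C A2 B2) * expR (- `|z|).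
  move=> A10 B10 A20 hAB k1 ls; rewrite (@le_trans _ _ (C A1 B1 * expR (- `|z|)))//.
    apply: le_trans (gauss_growth z A10 B10 hAB (lexx _) (near_norm_le ls)).
    rewrite !normrM (ger0_norm (ltW (gauss_gt0 z))) ler_wpM2r//.
    by rewrite mulr_ge0 ?(ltW (gauss_gt0 z)).
  by rewrite ler_wpM2r ?expR_ge0// lerDl C0.
apply: (@is_derive_dominated _ (fun l z => gauss z * g (x + l * z))
  (fun l z => z * (gauss z * dg (x + l * z))) s (C A B + C A' B')).
- by move=> l; exact: continuous_heat_integrand.
- move=> l z _.
  have := is_deriveZ (gauss z) (@is_derive_affine_comp g _ z x l (gE _)).
  by move/is_derive_eq; apply; rewrite /GRing.scale/=; ring.
- by move=> l z ls; rewrite -[X in `|X|]mul1r; apply: dom => //; rewrite normr1 lerDl.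
- by move=> l z ls; rewrite [C A B + _]addrC; apply: dom => //; rewrite lerDr.
Qed.

(** The heat equation: the factor [2 * s] cancels the derivative of the square
    root, so the right-hand side stays continuous up to [t = 0]. *)
Lemma is_derive_heat_t g dg ddg x t : 0 < t ->
  (forall y, is_derive y 1 g (dg y)) -> (forall y, is_derive y 1 dg (ddg y)) ->
  continuous ddg -> exp_growth g -> exp_growth dg -> exp_growth ddg ->
  is_derive t 1 (fun t => heat g x (Num.sqrt t)) (heat ddg x (Num.sqrt t)).
Proof.
move=> t0 gE dgE cddg gg gdg gddg.
have D := is_derive_heat_s x (Num.sqrt t) gE dgE cddg gg gdg gddg.
have := @is_derive1_comp _ _ _ t _ _ D (is_derive1_sqrt t0).
move/is_derive_eq; apply.
have s0 : Num.sqrt t != 0 by rewrite gt_eqF// sqrtr_gt0.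
by field.
Qed.

Lemma heat_at0 g x : heat g x 0 = g x * \int[mu]_z gauss z.
Proof.
rewrite -RintegralZl//; last first.
  have := @heat_integrable (cst 1) 0 0 (@cst_continuous _ _ _).
  rewrite (_ : (fun z => _) = gauss); last by apply/funext => z; rewrite mulr1.
  by apply; exists 1, 0; split => // y; rewrite normr1 mul0r expR0 mul1r.
by apply: eq_Rintegral => z _; rewrite mul0r addr0 mulrC.
Qed.

Lemma heat_gt0 g x s : continuous g -> exp_growth g -> (forall y, 0 < g y) ->
  0 < heat g x s.
Proof.
move=> cg gg g0.
pose f z := gauss z * g (x + s * z).
have f0 z : 0 < f z by rewrite mulr_gt0 ?gauss_gt0.
have cf : continuous f by exact: continuous_heat_integrand.
have h0 : 0 <= heat g x s by apply: Rintegral_ge0 => z _; exact: (ltW (f0 z)).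
rewrite lt_neqAle h0 andbT eq_sym; apply/negP => /eqP fint0.
have mf : measurable_fun [set: R] (EFin \o f).
  by apply/measurable_EFinP; exact: continuous_measurable_fun.
have intf : (\int[mu]_z `|(EFin \o f) z| = 0)%E.
  have fE : (\int[mu]_z (f z)%:E)%E = 0%E.
    have /(integrable_fin_num measurableT)/fineK <- := heat_integrable x s cg gg.
    by rewrite -[fine _]/(heat g x s) fint0.
  rewrite -[RHS]fE; apply: eq_integral => z _.
  by rewrite /= ger0_norm// (ltW (f0 z)).
move/(ae_eq_integral_abs mu measurableT mf) : intf => [N [mN N0 subN]].
have : mu N = mu [set: R].
  congr (mu _); apply/seteqP; split => // z _; apply: subN => /= /(_ I) [].
  by move/eqP; rewrite (gt_eqF (f0 z)).
by rewrite N0 -set_itvNyy lebesgue_measure_itv.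
Qed.

End Heat.

(** * Primitives *)
Section Primitive.
Context {R : realType}.
Local Notation mu := (@lebesgue_measure R).
Implicit Types (f g F : R -> R) (x y z a b m : R).

Lemma oint00 g : oint0 g 0 = 0 :> R.
Proof. by rewrite /oint0 lexx set_itv1 Rintegral_set1. Qed.

(** The two branches of [oint0] agree, to the right of a base point [M] below
    both 0 and [y], with a difference of two integrals from [M], to which
    the fundamental theorem of calculus applies. *)
Lemma is_derive_oint0 g y : continuous g -> is_derive y 1 (oint0 g) (g y).
Proof.
move=> cg; pose M := - (`|y| + 1).
have M0 : M < 0 by rewrite oppr_lt0 ltr_wpDl.
have My : M < y by have := ler_norm (- y); rewrite normrN /M; lra.
have ig a b : mu.-integrable `[a, b] (EFin \o g).
  apply: continuous_compact_integrable; first exact: segment_compact.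
  exact: continuous_subspaceT.
pose G z : R := (\int[mu]_(t in `[M, z]) g t).
have E z : M < z -> oint0 g z = G z - G 0.
  move=> Mz; rewrite /oint0; case: ifPn => [z0|].
    rewrite /G (Rintegral_itvB (ig _ _)) ?bnd_simp//; last exact: ltW.
    rewrite Rintegral_itv_obnd_cbnd//; apply: integrableS (ig 0 z) => //.
    exact: subset_itv_oc_cc.
  rewrite -ltNge => z0; rewrite -[RHS]opprB; congr (- _).
  rewrite /G (Rintegral_itvB (ig _ _)) ?bnd_simp//; last 2 first.
  - exact: ltW.
  - exact: ltW.
  rewrite Rintegral_itv_obnd_cbnd//; apply: integrableS (ig z 0) => //.
  exact: subset_itv_oc_cc.
apply: (@near_eq_is_derive _ _ _ (fun z => G z - G 0)).
  by near=> z; rewrite E//; near: z; exact: lt_nbhsr.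
have yy1 : y < y + 1 by rewrite ltrDl.
have [dG GE] := @continuous_FTC1_closed _ g M y (y + 1) yy1 (ig _ _) My (cg y).
have dGy : is_derive y 1 G (g y).
  by apply: DeriveDef; [exact: dG|rewrite -derive1E].
by have := is_deriveB dGy (is_derive_cst (G 0) y 1); rewrite subr0.
Unshelve. all: by end_near. Qed.

Lemma MVT_lower F f m a b : (forall y, is_derive y 1 F (f y)) ->
  (forall y, a <= y -> y <= b -> m <= f y) -> a <= b -> m * (b - a) <= F b - F a.
Proof.
move=> Ff fm ab; have [c /[!in_itv]/= /andP[ac cb] ->] :=
  @MVT_segment _ F f a b ab (fun y _ => Ff y)
    (continuous_subspaceT (is_derive_continuous Ff)).
by rewrite ler_wpM2r ?subr_ge0// fm.
Qed.

Lemma MVT_upper F f m a b : (forall y, is_derive y 1 F (f y)) ->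
  (forall y, a <= y -> y <= b -> f y <= m) -> a <= b -> F b - F a <= m * (b - a).
Proof.
move=> Ff fm ab; have [c /[!in_itv]/= /andP[ac cb] ->] :=
  @MVT_segment _ F f a b ab (fun y _ => Ff y)
    (continuous_subspaceT (is_derive_continuous Ff)).
by rewrite ler_wpM2r ?subr_ge0// fm.
Qed.

(** Comparison with the primitive of the upper bound of [f]. *)
Lemma primitive_powR_bound F f alpha kappa y : alpha < 1 ->
  (forall y, is_derive y 1 F (f y)) -> F 0 = 0 -> 0 <= kappa ->
  (forall y, 0 <= y -> 0 <= f y <= kappa / (1 + y) `^ alpha) ->
  0 <= y -> 0 <= F y <= kappa / (1 - alpha) * (1 + y) `^ (1 - alpha).
Proof.
move=> alpha1 Ff F0 kappa0 fk y0; apply/andP; split.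
  have f0 z : 0 <= z -> z <= y -> 0 <= f z by move=> /fk /andP[].
  by have := MVT_lower Ff f0 y0; rewrite F0 !subr0 mul0r.
pose C := kappa / (1 - alpha).
have a1 : 1 - alpha != 0 by rewrite subr_eq0 eq_sym lt_eqF.
have D z : 0 <= z ->
    is_derive z 1 (fun z => C * (1 + z) `^ (1 - alpha)) (kappa / (1 + z) `^ alpha).
  move=> z0; have z1 : 0 < 1 + z by rewrite ltr_wpDr.
  have dz : is_derive z 1 (fun z : R => 1 + z) 1.
    by have := is_deriveD (is_derive_cst (1:R) z 1) (is_derive_id z 1); rewrite add0r.
  have := is_deriveZ C
    (@is_derive1_comp _ _ _ _ _ _ (is_derive1_powR (1 - alpha) z1) dz).
  move/is_derive_eq; apply; rewrite /GRing.scale/= mulr1 addrAC subrr add0r powRN /C.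
  by rewrite mulrA divfK.
pose H z := C * (1 + z) `^ (1 - alpha) - F z.
have DH z : 0 <= z -> is_derive z 1 H (kappa / (1 + z) `^ alpha - f z).
  by move=> z0; exact: (is_deriveB (D z z0) (Ff z)).
have cH : {within `[0, y], continuous H}.
  apply: derivable_within_continuous => z; rewrite in_itv/= => /andP[z0 _].
  by have [] := DH z z0.
have [|c /[!in_itv]/= /andP[c0 cy]] := @MVT_segment _ H
    (fun z => kappa / (1 + z) `^ alpha - f z) 0 y y0 _ cH.
  by move=> z; rewrite in_itv/= => /andP[z0 _]; exact: DH (ltW z0).
rewrite /H F0 subr0 addr0 powR1 mulr1 subr0 => E.
have C0 : 0 <= C by rewrite divr_ge0// subr_ge0 ltW.
have : 0 <= (kappa / (1 + c) `^ alpha - f c) * y.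
  by rewrite mulr_ge0// subr_ge0; have /andP[] := fk c c0.
by rewrite -E -/C; lra.
Qed.

End Primitive.

(** * The initial data and its Cole transform *)
Section InitialData.
Context {R : realType}.
Implicit Types (f : R -> R) (x y z alpha : R).

Definition decay alpha y : R := (1 + `|y|) `^ (- alpha).

Lemma decay_gt0 alpha y : 0 < decay alpha y.
Proof. by rewrite powR_gt0// ltr_wpDr. Qed.

Lemma decay_le1 alpha y : 0 < alpha -> decay alpha y <= 1.
Proof.
by move=> a0; rewrite -(powRr0 (1 + `|y|)) ler_powR ?lerDl// oppr_le0 ltW.
Qed.

Lemma decayX alpha y n : decay alpha y ^+ n = (1 + `|y|) `^ (- (alpha * n%:R)).
Proof.
by rewrite -mulNr powRrM powR_mulrn// powR_ge0.
Qed.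

(** The bounds on the initial data in terms of powers of [decay alpha].  As
    [alpha < 1], the [i]-th derivative, of size [(1 + |y|) ^ (- alpha - i)], is at
    most of the order of [decay alpha y ^+ i.+1]: each derivative gains a factor
    [decay alpha], which is all that survives in the solution. *)
Record initial_data (j : nat) (kappa1 kappa2 alpha : R) (c : nat -> R)
    (f0 : R -> R) : Prop :=
  InitialData {
    initial_Ck : is_Ck j f0;
    initial_ge : forall y, kappa1 * decay alpha y <= f0 y;
    initial_le : forall y, f0 y <= kappa2 * decay alpha y;
    initial_jet : forall i y, (i <= j)%N ->
      `|f0^`(i) y| <= c i * decay alpha y ^+ i.+1 }.

Lemma initial_data_of_bounds (j : nat) (kappa1 kappa2 alpha : R)
    (lambda : 'I_j.+1 -> R) (f0 : R -> R) :
  (forall i, 0 < lambda i) -> alpha < 1 -> is_Ck j f0 ->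
  (forall y : R, kappa1 / (1 + `|y|) `^ alpha <= f0 y /\
                     f0 y <= kappa2 / (1 + `|y|) `^ alpha) ->
  (forall (i : 'I_j.+1) (y : R),
         `|f0^`(i) y| <= lambda i / (1 + `|y|) `^ (alpha + (i : nat)%:R)) ->
  initial_data j kappa1 kappa2 alpha (fun i => lambda (inord i)) f0.
Proof.
move=> l0 a1 ckf f0b f0d; split => //.
- by move=> y; rewrite /decay powRN; have [] := f0b y.
- by move=> y; rewrite /decay powRN; have [] := f0b y.
- move=> i y ij; have := f0d (inord i) y; rewrite inordK ?ltnS//.
  move=> /le_trans; apply; rewrite ler_wpM2l ?(ltW (l0 _))// -powRN decayX.
  rewrite ler_powR ?lerDl// lerN2 -natr1 mulrDr mulr1 addrC lerD2l.
  by rewrite ler_piMl// ltW.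
Qed.

(** The initial data of the heat equation to which Hopf and Cole reduce the
    Burgers equation. *)
Definition cole (f0 : R -> R) y : R := expR (- 2^-1 * oint0 f0 y).

(** The [i]-th derivative of [cole f0] is [cole f0] times this polynomial in the
    derivatives of [f0]; the second summand comes from differentiating
    [cole f0]. *)
Fixpoint cole_jet (i : nat) : dpoly R :=
  if i is i.+1 then
    DAdd (dderive (fun m => DVar m.+1) (cole_jet i))
         (DMul (DMul (DCst (- 2^-1)) (DVar 0)) (cole_jet i))
  else DCst 1.

Lemma homog_cole_jet i : homog i (cole_jet i).
Proof.
elim: i => [|i IHi] /=; first by left.
split; first by rewrite -addn1; apply: homog_dderive => // m; rewrite /= addn1.
exists (1%N, i) => //=; split=> //; exists (0%N, 1%N) => //=.
by split => //; left.
Qed.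

Definition cole_derive (f0 : R -> R) (i : nat) y : R :=
  cole f0 y * deval (fun m => f0^`(m) y) (cole_jet i).

Lemma cole_gt0 f0 y : 0 < cole f0 y.
Proof. exact: expR_gt0. Qed.

Lemma cole_derive0 f0 : cole_derive f0 0 = cole f0.
Proof. by apply/funext => y; rewrite /cole_derive/= mulr1. Qed.

Lemma cole_derive1 f0 y :
  cole_derive f0 1 y = - 2^-1 * f0 y * cole f0 y.
Proof. by rewrite /cole_derive/= add0r mulr1 mulrC. Qed.

Section FixedData.
Variables (j : nat) (kappa1 kappa2 alpha : R) (c : nat -> R) (f0 : R -> R).
Hypotheses (k10 : 0 < kappa1) (k20 : 0 < kappa2) (a0 : 0 < alpha) (a1 : alpha < 1).
Hypothesis hf0 : initial_data j kappa1 kappa2 alpha c f0.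

Lemma initial_derive i y : (i < j)%N -> is_derive y 1 (f0^`(i)) (f0^`(i.+1) y).
Proof.
move=> ij; have [/(_ i ij y) d _] := initial_Ck hf0.
by apply: DeriveDef; [exact: d|rewrite derive1nS derive1E].
Qed.

Lemma initial_continuous i : (i <= j)%N -> continuous (f0^`(i)).
Proof.
rewrite leq_eqVlt => /orP[/eqP ->|ij]; first by have [] := initial_Ck hf0.
by apply: (@is_derive_continuous _ _ (f0^`(i.+1))) => y; exact: initial_derive.
Qed.

Lemma is_derive_primitive y : is_derive y 1 (oint0 f0) (f0 y).
Proof. by apply: is_derive_oint0; exact: (@initial_continuous 0). Qed.

Lemma is_derive_cole y :
  is_derive y 1 (cole f0) (cole f0 y * (- 2^-1 * f0 y)).
Proof.
have D := is_deriveZ (- 2^-1) (is_derive_primitive y).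
exact: (@is_derive1_comp _ expR _ y _ _ (is_derive_expR _) D).
Qed.

Lemma is_derive_cole_derive i y : (i <= j)%N ->
  is_derive y 1 (cole_derive f0 i) (cole_derive f0 i.+1 y).
Proof.
move=> ij; have D : is_derive y 1 (fun z => deval (fun m => f0^`(m) z) (cole_jet i))
    (deval (fun m => f0^`(m) y) (dderive (fun m => DVar m.+1) (cole_jet i))).
  apply: (@is_derive_deval _ (fun m => f0^`(m)) _ _ _ i); first exact: homog_cole_jet.
  by move=> m mi; apply: initial_derive; exact: leq_trans mi ij.
have := is_deriveM (is_derive_cole y) D.
move/is_derive_eq; apply; rewrite /cole_derive /GRing.scale/=; ring.
Qed.

Lemma continuous_cole_derive i : (i <= j.+1)%N ->
  continuous (cole_derive f0 i).
Proof.
move=> ij y; apply: cvgM.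
  exact: (is_derive_continuous is_derive_cole).
apply: (@continuous_deval _ _ (fun m => f0^`(m)) _ i); first exact: homog_cole_jet.
by move=> m mi; apply: initial_continuous; rewrite -ltnS (leq_trans mi).
Qed.

Lemma primitive_linear y : `|oint0 f0 y| <= kappa2 * `|y|.
Proof.
have f0k z : f0 z <= kappa2.
  by rewrite (le_trans (initial_le hf0 z))// ler_piMr ?decay_le1// ltW.
have f00 z : 0 <= f0 z.
  by rewrite (le_trans _ (initial_ge hf0 z))// mulr_ge0 ?ltW ?decay_gt0.
have [y0|/ltW y0] := leP 0 y.
  have := MVT_lower is_derive_primitive (fun z _ _ => f00 z) y0.
  have := MVT_upper is_derive_primitive (fun z _ _ => f0k z) y0.
  by rewrite oint00 !subr0 mul0r => ? ?; rewrite !ger0_norm.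
have := MVT_lower is_derive_primitive (fun z _ _ => f00 z) y0.
have := MVT_upper is_derive_primitive (fun z _ _ => f0k z) y0.
rewrite oint00 !sub0r mul0r => ? ?.
by rewrite !ler0_norm// -oppr_ge0.
Qed.

Lemma primitive_bound y :
  `|oint0 f0 y| <= kappa2 / (1 - alpha) * (1 + `|y|) `^ (1 - alpha).
Proof.
have f0b z : 0 <= f0 z <= kappa2 / (1 + `|z|) `^ alpha.
  rewrite -powRN (initial_le hf0 z) andbT (le_trans _ (initial_ge hf0 z))//.
  by rewrite mulr_ge0 ?ltW ?decay_gt0.
have [y0|/ltW y0] := leP 0 y.
  have fb z : 0 <= z -> 0 <= f0 z <= kappa2 / (1 + z) `^ alpha.
    by move=> ?; have := f0b z; rewrite ger0_norm.
  have /andP[? ?] :=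
    primitive_powR_bound a1 is_derive_primitive (oint00 _) (ltW k20) fb y0.
  by rewrite [`|y|]ger0_norm// ger0_norm.
have D z : is_derive z 1 (fun z => - oint0 f0 (- z)) (f0 (- z)).
  have := @is_derive1_comp _ (oint0 f0) -%R z _ _ (is_derive_primitive _)
    (is_deriveN (is_derive_id z 1)).
  by move/is_deriveN/is_derive_eq; apply; rewrite mulrN1 opprK.
have Ny0 : 0 <= - y by rewrite oppr_ge0.
have fb z : 0 <= z -> 0 <= f0 (- z) <= kappa2 / (1 + z) `^ alpha.
  by move=> ?; have := f0b (- z); rewrite normrN ger0_norm.
have N0 : - oint0 f0 (- 0) = 0 by rewrite oppr0 oint00 oppr0.
have /andP[] := primitive_powR_bound a1 D N0 (ltW k20) fb Ny0; rewrite opprK => ? ?.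
by rewrite [`|y|]ler0_norm// -normrN ger0_norm.
Qed.

Lemma cole_derive_growth i C :
  (forall y, `|cole_derive f0 i y| <= C * (cole f0 y * decay alpha y ^+ i)) ->
  exp_growth (cole_derive f0 i).
Proof.
move=> wC; exists `|C|, (2^-1 * kappa2); split => //.
  by rewrite mulr_ge0// ltW.
move=> y; rewrite (le_trans (wC y))//.
have p0 : 0 <= cole f0 y * decay alpha y ^+ i.
  by rewrite mulr_ge0 ?exprn_ge0 ?(ltW (decay_gt0 _ _)) ?(ltW (cole_gt0 _ _)).
rewrite (le_trans (ler_wpM2r p0 (ler_norm C)))// ler_wpM2l//.
rewrite (@le_trans _ _ (cole f0 y))//.
  rewrite ler_piMr ?(ltW (cole_gt0 _ _))// exprn_ile1 ?decay_le1//.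
  exact: (ltW (decay_gt0 _ _)).
rewrite ler_expR -mulrA mulNr -mulrN ler_wpM2l//.
by rewrite (le_trans _ (primitive_linear y))// -normrN ler_norm.
Qed.

End FixedData.

Lemma cole_derive_bound j kappa1 kappa2 alpha c i : (forall m, 0 <= c m) ->
  (i <= j.+1)%N ->
  exists2 C : R, 0 <= C & forall f0, initial_data j kappa1 kappa2 alpha c f0 ->
    forall y, `|cole_derive f0 i y| <= C * (cole f0 y * decay alpha y ^+ i).
Proof.
move=> c0 ij; have [C C0 HC] := deval_bounded (homog_cole_jet i) c0.
exists C => // f0 hf0 y.
rewrite normrM gtr0_norm ?cole_gt0// [leRHS]mulrCA.
rewrite ler_wpM2l ?(ltW (cole_gt0 _ _))//.
apply: HC; first exact: (ltW (decay_gt0 _ _)).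
by move=> m mi; apply: (initial_jet hf0); rewrite -ltnS (leq_trans mi).
Qed.

End InitialData.

(** * Concentration away from the origin *)
Section Concentration.
Context {R : realType}.
Implicit Types (F : R -> R) (x y z t : R).

(** Minus the exponent of the Hopf-Cole weight. *)
Definition energy F x t y : R := (y - x) ^+ 2 / (4 * t) + F y / 2.

(** If the energy dropped neither at [y - b] nor at [y + L], where
    [b = delta * L], then neither would its average with the weights [L] and [b].
    These weights give [y] as the barycentre of the two points, so [x]
    disappears, and the quadratic part of the average exceeds its value at [y] by
    [L * b / (4 * t)], which is at most [delta * L `^ (1 - alpha) / 2].  From [y]
    to [y + L], [F] increases by at most [6 * C2 * L `^ (1 - alpha)], and this has
    the small weight [b]; from [y] to [y - b] it decreases by at least
    [kappa * (4 * delta) `^ (- alpha) * b * L `^ (- alpha)], and this has the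
    weight [L].  The choice of [delta] makes the decrease win. *)
Lemma energy_drop F (alpha kappa C2 delta L x t y : R) :
  0 < alpha -> alpha < 1 -> 0 <= C2 ->
  (forall y, `|F y| <= C2 * (1 + `|y|) `^ (1 - alpha)) ->
  (forall y y' M, y <= y' -> `|y| <= M -> `|y'| <= M ->
     kappa * (1 + M) `^ (- alpha) * (y' - y) <= F y' - F y) ->
  0 < delta -> 4 * delta <= 1 -> (4 * delta) `^ alpha * (6 + 6 * C2) <= kappa ->
  1 <= 2 * delta * L -> 0 < t -> L ^+ 2 <= 2 * L `^ (1 - alpha) * t ->
  `|y| <= delta * L ->
  energy F x t (y - delta * L) + delta * L `^ (1 - alpha) <= energy F x t y \/
  energy F x t (y + L) + delta * L `^ (1 - alpha) <= energy F x t y.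
Proof.
move=> a0 a1 C20 Fb Fl d0 d1 dk dL t0 Lt yd.
set N := L `^ (1 - alpha) in Lt *; set b := delta * L in yd *.
have L2 : 2 <= L by nra.
have b2 : 1 <= 2 * b by rewrite /b mulrA.
have L0 : 0 < L by lra.
have N0 : 0 < N by exact: powR_gt0.
have b0 : 0 < b by rewrite mulr_gt0.
have bL : 4 * b <= L by rewrite /b; nra.
pose c1 := kappa * (1 + 2 * b) `^ (- alpha).
have kappa0 : 0 < kappa.
  by rewrite (lt_le_trans _ dk)// mulr_gt0 ?powR_gt0//; lra.
have c1L : (6 + 6 * C2) * N <= c1 * L.
  have e1 : (4 * delta) `^ (- alpha) * L `^ (- alpha) <= (1 + 2 * b) `^ (- alpha).
    rewrite -powRM; [|by rewrite mulr_ge0 ?ler0n ?(ltW d0)|exact: ltW].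
    have p1 : 0 < 1 + 2 * b by lra.
    have p3 : 1 + 2 * b <= 4 * delta * L by rewrite -mulrA -/b; lra.
    have p2 := lt_le_trans p1 p3.
    rewrite !powRN lef_pV2 ?posrE ?powR_gt0//.
    by apply: ge0_ler_powR p3; rewrite ?nnegrE ltW.
  have e2 : N = L `^ (- alpha) * L.
    rewrite /N addrC powRD; last by rewrite (gt_eqF L0) implybT.
    by rewrite powRr1 ?ltW.
  have e3 : 6 + 6 * C2 <= kappa * (4 * delta) `^ (- alpha).
    by rewrite powRN ler_pdivlMr ?powR_gt0 ?mulr_gt0// mulrC.
  rewrite e2 mulrA ler_pM2r// /c1.
  apply: le_trans (_ : kappa * ((4 * delta) `^ (- alpha) * L `^ (- alpha)) <= _).
    by rewrite mulrA ler_wpM2r ?powR_ge0.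
  by rewrite ler_pM2l.
have left_slope : c1 * b <= F y - F (y - b).
  have := Fl (y - b) y (2 * b); rewrite (_ : y - (y - b) = b); last by ring.
  apply; first by lra.
    by rewrite (le_trans (ler_normB _ _))// (gtr0_norm b0); lra.
  by lra.
have right_growth : F (y + L) - F y <= 6 * C2 * N.
  have e4 u : `|u| <= 2 * L - 1 + L -> `|F u| <= 3 * C2 * N.
    move=> uL; rewrite (le_trans (Fb u))// [3 * _]mulrC -mulrA ler_wpM2l//.
    apply: le_trans (_ : (3 * L) `^ (1 - alpha) <= _).
      have u0 := normr_ge0 u.
      by apply: ge0_ler_powR; rewrite ?nnegrE; lra.
    rewrite powRM ?(ltW L0)// ler_wpM2r ?powR_ge0// ler1_powR//; lra.
  have nyL : `|y + L| <= 2 * L - 1 + L.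
    by rewrite (le_trans (ler_normD _ _))// (gtr0_norm L0); lra.
  have ny : `|y| <= 2 * L - 1 + L by lra.
  have := e4 _ nyL; have := e4 _ ny; rewrite !ler_norml => /andP[? ?] /andP[? ?]; lra.
set k := (4 * t)^-1.
have k0 : 0 < k by rewrite invr_gt0 mulr_gt0.
have kL : k * L ^+ 2 <= N / 2.
  rewrite /k mulrC ler_pdivrMr ?mulr_gt0//; lra.
have [h1|h1] := leP (energy F x t (y - b) + delta * N) (energy F x t y); first by left.
have [h2|h2] := leP (energy F x t (y + L) + delta * N) (energy F x t y); first by right.
exfalso; move: h1 h2; rewrite /energy -/k.
set A1 := F (y - b) in left_slope *; set A := F y in left_slope right_growth *.
set A2 := F (y + L) in right_growth * => h1 h2.
have s1 : L * ((y - x) ^+ 2 * k + A / 2) <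
    L * ((y - b - x) ^+ 2 * k + A1 / 2 + delta * N).
  by rewrite ltr_pM2l.
have s2 : b * ((y - x) ^+ 2 * k + A / 2) <
    b * ((y + L - x) ^+ 2 * k + A2 / 2 + delta * N).
  by rewrite ltr_pM2l.
have s3 : L * (c1 * b) <= L * (A - A1) by rewrite ler_pM2l.
have s4 : b * (A2 - A) <= b * (6 * C2 * N) by rewrite ler_pM2l.
have s5 : b * ((6 + 6 * C2) * N) <= b * (c1 * L) by rewrite ler_pM2l.
have s6 : (k * L ^+ 2) * (delta * (L + b)) <= (N / 2) * (delta * (L + b)).
  by rewrite ler_wpM2r// mulr_ge0 ?ltW// addr_gt0.
have s7 : delta * N * (4 * b) <= delta * N * L by rewrite ler_pM2l// mulr_gt0.
have s8 : 0 < delta * N * L by rewrite !mulr_gt0.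
have E : L * ((y - b - x) ^+ 2 * k) + b * ((y + L - x) ^+ 2 * k) -
    (L + b) * ((y - x) ^+ 2 * k) = (k * L ^+ 2) * (delta * (L + b)) by rewrite /b; ring.
have E2 : b * N = delta * N * L by rewrite /b; ring.
lra.
Qed.

End Concentration.

Section HeatDecay.
Context {R : realType}.
Local Notation mu := (@lebesgue_measure R).
Implicit Types (F : R -> R) (x y z t : R).

(** This is [L `^ (- alpha)] for the length scale
    [L = (1 + t) `^ (1 + alpha)^-1]. *)
Definition rate alpha t : R := (1 + t) `^ (- (alpha / (1 + alpha))).

Lemma rate_gt0 alpha t : 0 <= t -> 0 < rate alpha t.
Proof. by move=> t0; rewrite powR_gt0// ltr_wpDr. Qed.

(** From [expR u = (expR (u / p)) `^ p] and [u / p <= expR (u / p)]. *)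
Lemma expR_le_powR (p u : R) : 0 < p -> 0 < u -> expR (- u) <= (u / p) `^ (- p).
Proof.
move=> p0 u0; have up : 0 < u / p by rewrite divr_gt0.
rewrite expRN powRN lef_pV2 ?posrE ?expR_gt0 ?powR_gt0//.
rewrite -[u in leRHS](divfK (lt0r_neq0 p0)) expRM.
apply: ge0_ler_powR; rewrite ?nnegrE ?expR_ge0 ?(ltW p0) ?(ltW up)//.
by rewrite (le_trans _ (expR_ge1Dx _))// lerDr.
Qed.

Lemma small_scale_exists (alpha kappa C2 : R) : 0 < alpha -> 0 < kappa -> 0 <= C2 ->
  exists delta : R, [/\ 0 < delta, 4 * delta <= 1 &
    (4 * delta) `^ alpha * (6 + 6 * C2) <= kappa].
Proof.
move=> a0 k0 C20; have D0 : 0 < 6 + 6 * C2 by lra.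
pose e := Num.min 1 ((kappa / (6 + 6 * C2)) `^ alpha^-1).
have e0 : 0 < e by rewrite lt_min ltr01 powR_gt0// divr_gt0.
have e4 : 4 * (e / 4) = e by field.
exists (e / 4); rewrite e4; split.
- by rewrite divr_gt0.
- by rewrite ge_min lexx.
- rewrite -ler_pdivlMr//.
  apply: (@le_trans _ _ (((kappa / (6 + 6 * C2)) `^ alpha^-1) `^ alpha)).
    apply: ge0_ler_powR; rewrite ?nnegrE ?powR_ge0 ?(ltW a0) ?(ltW e0)//.
    by rewrite ge_min lexx orbT.
  by rewrite -powRrM mulVf ?gt_eqF// powRr1// divr_ge0 ?ltW.
Qed.

(** The Hopf-Cole weight in the variable [z]. *)
Definition gauss_cole (f0 : R -> R) x s z : R :=
  gauss z * cole f0 (x + s * z).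

Lemma gauss_coleE (f0 : R -> R) x t z : 0 < t ->
  gauss_cole f0 x (Num.sqrt t) z =
  expR (- energy (oint0 f0) x t (x + Num.sqrt t * z)).
Proof.
move=> t0; rewrite /gauss_cole /gauss /cole -expRD /energy; congr expR.
rewrite [x + _]addrC addrK exprMn sqr_sqrtr ?ltW//.
by field; rewrite gt_eqF.
Qed.

(** Away from the origin, [decay] itself has the size [rate]; near the origin,
    [energy_drop] makes the weight exponentially small compared with one of two
    translates.  Translates of the weight are harmless, since they have the same
    integral. *)
Lemma gauss_cole_concentration (kappa1 kappa2 alpha : R) (i : nat) :
  0 < kappa1 -> 0 < kappa2 -> 0 < alpha -> alpha < 1 ->
  exists2 C : R, 0 <= C & forall j c f0, initial_data j kappa1 kappa2 alpha c f0 ->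
    forall x t, 0 <= t -> exists p q : R, forall z,
    gauss_cole f0 x (Num.sqrt t) z * decay alpha (x + Num.sqrt t * z) ^+ i <=
    C * rate alpha t ^+ i * (gauss_cole f0 x (Num.sqrt t) z +
      gauss_cole f0 x (Num.sqrt t) (p + z) + gauss_cole f0 x (Num.sqrt t) (q + z)).
Proof.
move=> k10 k20 a0 a1; have oa0 : 0 < 1 - alpha by rewrite subr_gt0.
pose C2 := kappa2 / (1 - alpha).
have C20 : 0 <= C2 by rewrite divr_ge0// ltW.
have [delta [d0 d1 dk]] := small_scale_exists a0 k10 C20.
(* With this exponent, [(L `^ (1 - alpha)) `^ (- p)] is at most
   [L `^ (- alpha)] to the power [i]; [i.+1] keeps it positive when [i = 0]. *)
pose p := alpha * i.+1%:R / (1 - alpha).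
have p0 : 0 < p by rewrite divr_gt0// mulr_gt0.
pose Ca := (2 * delta) `^ (- (alpha * i%:R)).
pose Cb := delta `^ (- (alpha * i%:R)).
pose Cc := (delta / p) `^ (- p).
have Ca0 : 0 <= Ca by exact: powR_ge0.
have Cb0 : 0 <= Cb by exact: powR_ge0.
have Cc0 : 0 <= Cc by exact: powR_ge0.
exists (Ca + Cb + Cc); first by rewrite !addr_ge0.
move=> j c f0 hf0 x t t0; set s := Num.sqrt t.
have w0 z : 0 < gauss_cole f0 x s z.
  exact: mulr_gt0 (gauss_gt0 _) (cole_gt0 _ _).
pose L := (1 + t) `^ (1 + alpha)^-1.
have t1 : 0 < 1 + t by rewrite ltr_wpDr.
have L0 : 0 < L by exact: powR_gt0.
have L1 : 1 <= L.
  by rewrite -(powRr0 (1 + t)) ler_powR ?lerDl// invr_ge0; lra.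
have LrateX m : rate alpha t ^+ m = L `^ (- (alpha * m%:R)).
  rewrite /rate /L -powRrM -powR_mulrn ?powR_ge0// -powRrM; congr (_ `^ _).
  by rewrite !mulrN !mulNr [(1 + alpha)^-1 * _]mulrC mulrAC.
have r0 : 0 < rate alpha t by exact: rate_gt0.
have rX0 : 0 <= rate alpha t ^+ i by rewrite exprn_ge0// ltW.
have dec0 y : 0 <= decay alpha y ^+ i by rewrite exprn_ge0// ltW// decay_gt0.
have dec1 y : decay alpha y ^+ i <= 1.
  by rewrite exprn_ile1// ?decay_le1// ltW// decay_gt0.
have ai0 : 0 <= alpha * i%:R by rewrite mulr_ge0// ltW.
have negpow u v : 0 < u -> u <= v ->
    v `^ (- (alpha * i%:R)) <= u `^ (- (alpha * i%:R)).
  move=> u0 uv; have v0 := lt_le_trans u0 uv.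
  rewrite !powRN lef_pV2 ?posrE ?powR_gt0//.
  by apply: ge0_ler_powR uv; rewrite ?nnegrE ?(ltW u0) ?(ltW v0).
(* Where the decay factor is small, the translates are not needed. *)
have here z D (q1 q2 : R) : 0 <= D -> D <= Ca + Cb + Cc ->
    decay alpha (x + s * z) ^+ i <= D * rate alpha t ^+ i ->
    gauss_cole f0 x s z * decay alpha (x + s * z) ^+ i <=
    (Ca + Cb + Cc) * rate alpha t ^+ i * (gauss_cole f0 x s z +
      gauss_cole f0 x s (q1 + z) + gauss_cole f0 x s (q2 + z)).
  move=> D0 DC dD; rewrite mulrC; apply: ler_pM => //; first exact: ltW.
    by rewrite (le_trans dD)// ler_wpM2r.
  by rewrite -addrA lerDl addr_ge0// ltW.
(* For bounded times, [rate] is bounded from below. *)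
have [dL|/ltW dL] := leP (2 * delta * L) 1.
  exists 0, 0 => z; apply: (here z Ca) => //; first lra.
  rewrite (le_trans (dec1 _))// LrateX -powRM ?mulr_ge0 ?(ltW d0) ?(ltW L0)//.
  have := @negpow (2 * delta * L) 1 _ dL; rewrite powR1; apply.
  by rewrite !mulr_gt0.
have L2 : 2 <= L by nra.
have LL : L ^+ 2 = L `^ (1 - alpha) * (1 + t).
  have -> : 1 + t = L `^ (1 + alpha).
    by rewrite /L -powRrM mulVf ?powRr1 ?(ltW t1)//; rewrite gt_eqF//; lra.
  rewrite -powRD; last by rewrite (gt_eqF L0) implybT.
  by rewrite -powR_mulrn ?(ltW L0)//; congr (_ `^ _); ring.
have tge1 : 1 <= t.
  have : L <= 1 + t by rewrite ler1_powR ?lerDl// invf_le1; lra.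
  lra.
have tp : 0 < t by lra.
have s0 : 0 < s by rewrite sqrtr_gt0.
exists (- (delta * L) / s), (L / s) => z.
have [yd|/ltW yd] := leP `|x + s * z| (delta * L); last first.
  apply: (here z Cb) => //; first lra.
  rewrite decayX LrateX -powRM ?(ltW d0) ?(ltW L0)//; apply: negpow.
    exact: mulr_gt0.
  by rewrite (le_trans yd)// lerDr.
pose N := L `^ (1 - alpha).
have N0 : 0 < N by exact: powR_gt0.
have eN : expR (- (delta * N)) <= Cc * rate alpha t ^+ i.
  apply: (le_trans (expR_le_powR p0 _)); first exact: mulr_gt0.
  rewrite mulrAC powRM ?(ltW N0)//; last by rewrite divr_ge0 ?ltW.
  rewrite ler_wpM2l// LrateX -powRrM ler_powR//.
  rewrite mulrN lerN2 [leRHS]mulrC /p divfK ?(gt_eqF oa0)// ler_wpM2l ?(ltW a0)//.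
  by rewrite ler_nat.
have Fl y y' M : y <= y' -> `|y| <= M -> `|y'| <= M ->
    kappa1 * (1 + M) `^ (- alpha) * (y' - y) <= oint0 f0 y' - oint0 f0 y.
  move=> yy' yM y'M; apply: MVT_lower yy'; first exact: is_derive_primitive hf0.
  move=> v yv vy'; apply: le_trans (initial_ge hf0 v).
  rewrite ler_pM2l// /decay !powRN lef_pV2 ?posrE ?powR_gt0 ?ltr_wpDr ?(le_trans _ yM)//.
  apply: ge0_ler_powR; rewrite ?nnegrE ?addr_ge0 ?(le_trans _ yM) ?(ltW a0)// lerD2l.
  by move: yM y'M; rewrite !ler_norml => /andP[? ?] /andP[? ?]; apply/andP; split; lra.
have key y' :
    energy (oint0 f0) x t y' + delta * N <= energy (oint0 f0) x t (x + s * z) ->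
    gauss_cole f0 x s z <=
    Cc * rate alpha t ^+ i * expR (- energy (oint0 f0) x t y').
  move=> H; rewrite (gauss_coleE f0 x z tp) -/s.
  apply: (@le_trans _ _ (expR (- (delta * N)) * expR (- energy (oint0 f0) x t y'))).
    by rewrite -expRD ler_expR; lra.
  by rewrite ler_wpM2r ?expR_ge0.
have shiftE q : expR (- energy (oint0 f0) x t (x + s * z + q)) =
    gauss_cole f0 x s (q / s + z).
  have E : s * (q / s + z) = q + s * z by rewrite mulrDr mulrCA divff ?mulr1// gt_eqF.
  by rewrite (gauss_coleE f0 x _ tp) -/s E [q + _]addrC addrA.
rewrite (@le_trans _ _ (gauss_cole f0 x s z))//.
  by rewrite ler_piMr// ltW.
have CcD : Cc * rate alpha t ^+ i <= (Ca + Cb + Cc) * rate alpha t ^+ i.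
  by rewrite ler_wpM2r//; lra.
have Lt : L ^+ 2 <= 2 * N * t.
  by rewrite LL -/N [2 * N]mulrC -mulrA ler_pM2l//; lra.
have last_step (u v : R) : 0 <= u -> 0 <= v -> Cc * rate alpha t ^+ i * u <=
    (Ca + Cb + Cc) * rate alpha t ^+ i * (v + u).
  move=> u0 v0; apply: (le_trans (ler_wpM2r u0 CcD)).
  by rewrite ler_wpM2l ?lerDr// mulr_ge0// !addr_ge0.
have wn z' := ltW (w0 z').
have Fb := primitive_bound k10 k20 a1 hf0.
have [/key|/key] := energy_drop x a0 a1 C20 Fb Fl d0 d1 dk dL tp Lt yd.
- rewrite shiftE => /le_trans; apply; rewrite [X in _ <= _ * X]addrAC.
  exact: last_step (wn _) (addr_ge0 (wn _) (wn _)).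
- rewrite shiftE => /le_trans; apply.
  exact: last_step (wn _) (addr_ge0 (wn _) (wn _)).
Qed.

Lemma Rintegral_sum_shifts (psi : R -> R) (p q D : R) :
  continuous psi -> exp_dominated psi ->
  mu.-integrable [set: R]
    (EFin \o (fun z => D * (psi z + psi (p + z) + psi (q + z)))) /\
  \int[mu]_z (D * (psi z + psi (p + z) + psi (q + z))) = D * 3 * \int[mu]_z psi z.
Proof.
move=> psic psid.
have psiS u : continuous (fun z => psi (u + z)).
  rewrite (_ : (fun z => _) = (fun z => psi (u + 1 * z))); last first.
    by apply/funext => z; rewrite mul1r.
  exact: continuous_affine.
have psidS u := exp_dominated_shift u psid.
have ipsi := exp_dominated_integrable psic psid.
have ipsiS u := exp_dominated_integrable (psiS u) (psidS u).
have psi2c : continuous (fun z => psi z + psi (p + z)).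
  by move=> z; apply: cvgD; [exact: psic|exact: psiS].
have psi3c : continuous (fun z => psi z + psi (p + z) + psi (q + z)).
  by move=> z; apply: cvgD; [exact: psi2c|exact: psiS].
have psi2d := exp_dominatedD psid (psidS p).
have i2 := exp_dominated_integrable psi2c psi2d.
have psi3d := exp_dominatedD psi2d (psidS q).
have i3 := exp_dominated_integrable psi3c psi3d.
split.
  apply: exp_dominated_integrable (exp_dominatedZ _ psi3d).
  by move=> z; apply: cvgMr; exact: psi3c.
rewrite (RintegralZl _ measurableT i3) (RintegralD measurableT i2 (ipsiS q)).
rewrite (RintegralD measurableT ipsi (ipsiS p)).
rewrite (Rintegral_shift p psic psid) (Rintegral_shift q psic psid).
ring.
Qed.

Lemma cole_growth j kappa1 kappa2 alpha c (f0 : R -> R) :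
  0 < kappa1 -> 0 < kappa2 -> 0 < alpha ->
  initial_data j kappa1 kappa2 alpha c f0 -> exp_growth (cole f0).
Proof.
move=> k10 k20 a0 hf0; rewrite -cole_derive0.
apply: (cole_derive_growth k10 k20 a0 hf0 (C := 1)) => y.
by rewrite cole_derive0 expr0 mulr1 mul1r gtr0_norm// cole_gt0.
Qed.

Lemma heat_cole_derive_decay j (kappa1 kappa2 alpha : R) c (i : nat) :
  0 < kappa1 -> 0 < kappa2 -> 0 < alpha -> alpha < 1 ->
  (forall m, 0 <= c m) -> (i <= j.+1)%N ->
  exists2 C : R, 0 <= C & forall f0, initial_data j kappa1 kappa2 alpha c f0 ->
    forall x t, 0 <= t ->
    `|heat (cole_derive f0 i) x (Num.sqrt t)| <=
    C * rate alpha t ^+ i * heat (cole f0) x (Num.sqrt t).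
Proof.
move=> k10 k20 a0 a1 c0 ij.
have [C C0 HC] := cole_derive_bound kappa1 kappa2 alpha c0 ij.
have [D D0 HD] := gauss_cole_concentration i k10 k20 a0 a1.
exists (C * D * 3); first by rewrite !mulr_ge0.
move=> f0 hf0 x t t0; set s := Num.sqrt t; set r := rate alpha t ^+ i.
have r0 : 0 <= r by rewrite exprn_ge0// ltW// rate_gt0.
have [p [q pq]] := HD _ _ _ hf0 x t t0; rewrite -/s -/r in pq.
have wg := cole_derive_growth k10 k20 a0 hf0 (HC _ hf0).
have wc := continuous_cole_derive hf0 ij.
have vg := cole_growth k10 k20 a0 hf0.
have vc : continuous (cole f0).
  by rewrite -cole_derive0; exact: (continuous_cole_derive hf0 (leq0n _)).
pose psi := gauss_cole f0 x s.
have psic : continuous psi by exact: continuous_heat_integrand.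
have psid : exp_dominated psi by exact: heat_dominated.
have [isum sumE] := Rintegral_sum_shifts p q (C * D * r) psic psid.
have iw := heat_integrable x s wc wg.
apply: le_trans (le_normr_Rintegral measurableT iw) _.
apply: le_trans (le_Rintegral measurableT (integrable_norm iw) isum _) _.
  move=> z _ /=; rewrite normrM (gtr0_norm (gauss_gt0 z)).
  rewrite (le_trans (ler_wpM2l (ltW (gauss_gt0 z)) (HC _ hf0 _)))//.
  rewrite mulrCA -!mulrA ler_wpM2l// [leLHS]mulrA.
  by have := pq z; rewrite -[D * r * _]mulrA.
by rewrite sumE -/(heat (cole f0) x s) [C * D * 3 * r]mulrAC.
Qed.

End HeatDecay.

(** * One-sided time derivatives *)
Section TimeDerivative.
Context {R : realType}.
Implicit Types (g G : R -> R) (x y z t s : R).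

Lemma time_filter_proper t : 0 <= t -> ProperFilter (within `[0, +oo[ t^').
Proof.
move=> t0; apply: Build_ProperFilter_ex => P.
rewrite /within /= => /nbhs_ballP[e /= e0] H.
exists (t + e / 2); apply: (H (t + e / 2)) => /=.
- rewrite /ball /= opprD addNKr normrN gtr0_norm ?divr_gt0//.
  by rewrite ltr_pdivrMr// ltr_pMr// ltr1n.
- by rewrite gt_eqF// ltrDl divr_gt0.
- by rewrite in_itv/= andbT addr_ge0// divr_ge0// ltW.
Qed.

(** By the mean value theorem a difference quotient is a value of [dG] at an
    intermediate point; the continuity of [dG] then handles the end point 0 like
    any other. *)
Lemma time_quotient_cvg g G dG t : (forall s, 0 <= s -> g s = G s) ->
  continuous G -> continuous dG ->
  (forall s, 0 < s -> is_derive s 1 G (dG s)) -> 0 <= t ->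
  time_quotient g t @ within `[0, +oo[ t^' --> dG t.
Proof.
move=> gG cG cdG GE t0.
have slope a b : 0 <= a -> a < b ->
    exists2 c, a < c < b & G b - G a = dG c * (b - a).
  move=> a0 ab.
  have Gab s : s \in `]a, b[%R -> is_derive s 1 G (dG s).
    by rewrite in_itv/= => /andP[sa _]; apply: GE; exact: le_lt_trans sa.
  have [c cab E] := MVT ab Gab (continuous_subspaceT cG).
  by exists c => //; move: cab; rewrite in_itv.
apply/cvgrPdist_lt => e e0.
have /cvgrPdist_lt/(_ e e0)/nbhs_ballP[d /= d0 Hd] := cdG t.
rewrite /nbhs /= /within /=; apply/nbhs_ballP; exists d => //= s sd st s0.
have {}s0 : 0 <= s by move: s0; rewrite in_itv/= andbT.
rewrite /time_quotient !gG//.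
have [c ct ->] : exists2 c, `|t - c| < d & (G s - G t) / (s - t) = dG c;
  last exact: Hd.
move: sd; rewrite /ball/= => sd.
have [ts|ts|ts] := ltgtP s t; last by rewrite ts eqxx in st.
- have [c /andP[sc ct] E] := slope s t s0 ts; exists c.
    by move: sd; rewrite !gtr0_norm ?subr_gt0// => ?; lra.
  by rewrite -opprB -[s - t]opprB E invrN mulrNN mulfK// subr_eq0 gt_eqF.
- have [c /andP[tc cs] E] := slope t s t0 ts; exists c.
    by move: sd; rewrite !ltr0_norm ?subr_lt0// => ?; lra.
  by rewrite E mulfK// subr_eq0 gt_eqF.
Qed.

Lemma time_deriveE g G dG t : (forall s, 0 <= s -> g s = G s) ->
  continuous G -> continuous dG ->
  (forall s, 0 < s -> is_derive s 1 G (dG s)) -> 0 <= t ->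
  time_derivable g t /\ time_derive g t = dG t.
Proof.
move=> gG cG cdG GE t0; have H := time_quotient_cvg gG cG cdG GE t0.
have PF := time_filter_proper t0.
split; first by apply/cvg_ex; exists (dG t).
by apply: cvg_lim => //; exact: norm_hausdorff.
Qed.

End TimeDerivative.

(** * The solution of the Burgers equation *)
Section Burgers.
Context {R : realType}.
Local Notation mu := (@lebesgue_measure R).
Implicit Types (x y z t s : R).

(** In terms of the heat extension [v] of [cole f0], this is the quotient of the
    space derivative of order [i.+1] of [v] by [v]. *)
Definition heat_quotient (f0 : R -> R) (i : nat) x t : R :=
  heat (cole_derive f0 i.+1) x (Num.sqrt t) /
  heat (cole f0) x (Num.sqrt t).

(** The space derivative of [heat_quotient f0 i], by the quotient rule. *)
Definition dx_quotient (i : nat) : dpoly R :=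
  DAdd (DVar i.+1) (DMul (DCst (-1)) (DMul (DVar i) (DVar 0))).

(** The time derivative of [heat_quotient f0 i]: by the heat equation, time
    derivatives are space derivatives of twice the order. *)
Definition dt_quotient (i : nat) : dpoly R :=
  DAdd (DVar i.+2) (DMul (DCst (-1)) (DMul (DVar i) (DVar 1))).

(** The derivative of order [n] in time and [k] in space of
    [- 2 * heat_quotient f0 0], which is the solution. *)
Definition burgers_dpoly (n k : nat) : dpoly R :=
  iter n (dderive dt_quotient)
    (iter k (dderive dx_quotient) (DMul (DCst (-2)) (DVar 0))).

Lemma homog_dx i : homog (i.+1 + 1) (dx_quotient i).
Proof.
split=> /=; first by rewrite addn1.
exists (0%N, (i.+1 + 1)%N) => //=; split; first by left.
by exists (i.+1, 1%N).
Qed.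

Lemma homog_dt i : homog (i.+1 + 2) (dt_quotient i).
Proof.
split=> /=; first by rewrite addn2.
exists (0%N, (i.+1 + 2)%N) => //=; split; first by left.
by exists (i.+1, 2%N).
Qed.

Lemma homog_burgers n k : homog (1 + k + 2 * n) (burgers_dpoly n k).
Proof.
elim: n => [|n IHn] /=.
  rewrite muln0 addn0 /burgers_dpoly /=; elim: k => [|k IHk] /=.
    by exists (0%N, 1%N) => //=; split => //; left.
  by rewrite addnS -addn1; apply: homog_dderive IHk => i; exact: homog_dx.
rewrite mulnS [(2 + _)%N]addnC addnA; apply: homog_dderive IHn => i.
exact: homog_dt.
Qed.

Section FixedSolution.
Variables (j : nat) (kappa1 kappa2 alpha : R) (c : nat -> R) (f0 : R -> R).
Hypotheses (k10 : 0 < kappa1) (k20 : 0 < kappa2) (a0 : 0 < alpha).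
Hypothesis c0 : forall m, 0 <= c m.
Hypothesis hf0 : initial_data j kappa1 kappa2 alpha c f0.

Local Notation w := (cole_derive f0).
Local Notation U := (heat_quotient f0).

Let cw i (ij : (i <= j.+1)%N) := continuous_cole_derive hf0 ij.
Let dw i (ij : (i <= j)%N) y := is_derive_cole_derive hf0 y ij.

Let gw i : (i <= j.+1)%N -> exp_growth (w i).
Proof.
move=> ij; have [C _ HC] := cole_derive_bound kappa1 kappa2 alpha c0 ij.
exact: (cole_derive_growth k10 k20 a0 hf0 (HC _ hf0)).
Qed.

Lemma heat_cole_gt0 x s : 0 < heat (cole f0) x s.
Proof.
rewrite -cole_derive0; apply: heat_gt0.
- exact: (continuous_cole_derive hf0 (leq0n _)).
- exact: gw (leq0n _).
- by move=> y; rewrite cole_derive0; exact: cole_gt0.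
Qed.

(** The Hopf-Cole formula after the substitution [y = x + sqrt t * z]: the factor
    [(x - y) / t] becomes [- z / sqrt t], and [heat_moment] applies. *)
Lemma burgers_solutionE x t : 0 <= t -> burgers_solution f0 x t = -2 * U 0 x t.
Proof.
rewrite le_eqVlt => /orP[/eqP <-|t0].
  rewrite /burgers_solution ltxx /heat_quotient sqrtr0 !heat_at0.
  have := heat_cole_gt0 x 0; rewrite heat_at0.
  set G := (\int[mu]_z _)%R => G0.
  have p0 := cole_gt0 f0 x; have {}G0 : 0 < G by rewrite -(pmulr_rgt0 _ p0).
  rewrite cole_derive1; field.
  by rewrite !gt_eqF.
rewrite /burgers_solution t0; set s := Num.sqrt t.
have s0 : 0 < s by rewrite sqrtr_gt0.
have ts : t = s * s by rewrite -expr2 sqr_sqrtr// ltW.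
have wE z :
    hopf_cole_weight f0 x t (x + s * z) = gauss z * cole f0 (x + s * z).
  rewrite /hopf_cole_weight /gauss /cole -expRD; congr expR.
  rewrite [- 2^-1 * _]mulNr; congr (_ - _).
  by rewrite opprD addNKr sqrrN ts; field; rewrite gt_eqF.
have wE1 z : (x - (x + s * z)) / t * hopf_cole_weight f0 x t (x + s * z) =
    - s^-1 * (z * (gauss z * cole f0 (x + s * z))).
  rewrite wE opprD addNKr ts; field.
  by rewrite gt_eqF.
have vc : continuous (cole f0).
  by rewrite -cole_derive0; exact: (continuous_cole_derive hf0 (leq0n _)).
have vg : exp_growth (cole f0).
  by rewrite -cole_derive0; exact: gw (leq0n _).
have hc := @continuous_heat_integrand _ _ x s vc.
have hd := @heat_dominated _ _ x s vg.
have md := @heat_moment_dominated _ _ x s vg.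
have mc : continuous (fun z => z * (gauss z * cole f0 (x + s * z))).
  by move=> z; apply: cvgM; [exact: cvg_id|exact: hc].
have unscale (f g : R -> R) :
    (forall z, f (x + s * z) = g z) -> continuous g -> continuous f.
  move=> fg cg; have -> : f = fun y => g (- (x / s) + s^-1 * y).
    apply/funext => y; rewrite -fg; congr f; rewrite mulrDr mulrN mulrCA.
    rewrite divff ?gt_eqF// mulr1 mulrA divff ?gt_eqF// mul1r; ring.
  exact: continuous_affine.
have iE := exp_dominated_integrable mc md.
have dv y : is_derive y 1 (cole f0) (w 1 y).
  by rewrite -cole_derive0; exact: (dw (leq0n j) y).
have mom := @heat_moment _ _ _ x s dv (cw (ltn0Sn j)) vg (gw (ltn0Sn j)).
rewrite (@Rintegral_affine _ s x _ s0 (unscale _ _ wE1 _)); last 2 first.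
- by move=> z; apply: cvgMr; exact: mc.
- by under eq_fun do rewrite wE1; exact: exp_dominatedZ md.
rewrite (@Rintegral_affine _ s x _ s0 (unscale _ _ wE hc)); last first.
  by under eq_fun do rewrite wE.
under eq_Rintegral do rewrite wE1.
under [X in _ / (_ * X)]eq_Rintegral do rewrite wE.
rewrite (RintegralZl _ measurableT iE) mom -/(heat (cole f0) x s) /heat_quotient -/s.
have := heat_cole_gt0 x s => h0; field.
by rewrite !gt_eqF.
Qed.

Let heat0_gt0 x s : 0 < heat (w 0) x s.
Proof. by rewrite cole_derive0; exact: heat_cole_gt0. Qed.

Let UfunE i x : U i x =
  fun t => heat (w i.+1) x (Num.sqrt t) / heat (w 0) x (Num.sqrt t).
Proof. by apply/funext => t; rewrite /heat_quotient cole_derive0. Qed.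

Let UE i x t : U i x t = heat (w i.+1) x (Num.sqrt t) / heat (w 0) x (Num.sqrt t).
Proof. by rewrite UfunE. Qed.

Lemma is_derive_heat_quotient_x i x t : (i.+1 <= j)%N ->
  is_derive x 1 (fun x => U i x t) (deval (fun m => U m x t) (dx_quotient i)).
Proof.
move=> ij; rewrite /= !UE; under eq_fun do rewrite UE.
apply: is_derive_quotient.
- by rewrite gt_eqF// heat0_gt0.
- exact: (is_derive_heat_x _ _ (dw ij) (cw (i:=i.+2) ij)
    (gw (i:=i.+1) (leqW ij)) (gw (i:=i.+2) ij)).
- exact: (is_derive_heat_x _ _ (dw (leq0n j)) (cw (ltn0Sn j))
    (gw (leq0n _)) (gw (ltn0Sn j))).
Qed.

Lemma is_derive_heat_quotient_t i x t : 0 < t -> (i.+2 <= j)%N ->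
  is_derive t 1 (U i x) (deval (fun m => U m x t) (dt_quotient i)).
Proof.
move=> t0 ij; rewrite /= !UE UfunE.
have j2 : (2 <= j.+1)%N by rewrite ltnS (leq_trans _ ij).
have j1 : (1 <= j)%N by rewrite (leq_trans _ ij).
apply: (is_derive_quotient (f := fun t => heat (w i.+1) x (Num.sqrt t))
  (g := fun t => heat (w 0) x (Num.sqrt t))).
- by rewrite gt_eqF// heat0_gt0.
- exact: (is_derive_heat_t x t0 (dw (ltnW ij)) (dw ij) (cw (i:=i.+3) ij)
    (gw (leqW (ltnW ij))) (gw (leqW ij)) (gw (i:=i.+3) ij)).
- exact: (is_derive_heat_t x t0 (dw (leq0n j)) (dw j1) (cw j2)
    (gw (leq0n _)) (gw (leqW j1)) (gw j2)).
Qed.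

Lemma continuous_heat_quotient i x : (i <= j)%N -> continuous (U i x).
Proof.
move=> ij; have cs k : (k <= j.+1)%N ->
    continuous (fun t => heat (w k) x (Num.sqrt t)).
  move=> kj t; apply: (@continuous_comp _ _ _ Num.sqrt (heat (w k) x)).
    exact: sqrt_continuous.
  by apply: continuous_heat; [exact: cw|exact: gw].
rewrite UfunE => t; apply: cvgM; first exact: (cs i.+1 ij).
apply: cvgV; first by rewrite gt_eqF// heat0_gt0.
exact: (cs 0 (leq0n _)).
Qed.

Lemma is_derive_burgers_dpoly_x k x t : (k < j)%N ->
  is_derive x 1 (fun x => deval (fun m => U m x t) (burgers_dpoly 0 k))
    (deval (fun m => U m x t) (burgers_dpoly 0 k.+1)).
Proof.
move=> kj; apply: (is_derive_deval (X := fun m x => U m x t) (homog_burgers 0 k)) => i.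
by rewrite muln0 addn0 => ik; apply: is_derive_heat_quotient_x; exact: leq_trans ik kj.
Qed.

Lemma burgers_space_jet k t : (k <= j)%N -> 0 <= t ->
  ((burgers_solution f0)^~ t)^`(k) =
  fun x => deval (fun m => U m x t) (burgers_dpoly 0 k).
Proof.
move=> + t0; elim: k => [|k IHk] kj.
  by apply/funext => x; rewrite derive1n0 (burgers_solutionE x t0).
rewrite derive1nS IHk ?(ltnW kj)//; apply/funext => x.
by rewrite derive1E; apply: derive_val; exact: is_derive_burgers_dpoly_x.
Qed.

Lemma burgers_time_jet n k x : (2 * n.+1 + k <= j)%N ->
  (forall t, 0 <= t -> partial_tx n k (burgers_solution f0) x t =
    deval (fun m => U m x t) (burgers_dpoly n k)) ->
  forall t, 0 <= t -> time_derivable (partial_tx n k (burgers_solution f0) x) t /\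
    partial_tx n.+1 k (burgers_solution f0) x t =
    deval (fun m => U m x t) (burgers_dpoly n.+1 k).
Proof.
move=> nk IH t t0.
apply: (time_deriveE
  (dG := fun t => deval (fun m => U m x t) (burgers_dpoly n.+1 k)) IH) => //.
- apply: (continuous_deval (X := fun m => U m x) (homog_burgers n k)) => i ink.
  by apply: continuous_heat_quotient; lia.
- apply: (continuous_deval (X := fun m => U m x) (homog_burgers n.+1 k)) => i ink.
  by apply: continuous_heat_quotient; lia.
- move=> s s0.
  apply: (is_derive_deval (X := fun m => U m x) (homog_burgers n k)) => i ink.
  by apply: is_derive_heat_quotient_t => //; lia.
Qed.

Lemma partial_txE n k x t : (2 * n + k <= j)%N -> 0 <= t ->
  partial_tx n k (burgers_solution f0) x t =
  deval (fun m => U m x t) (burgers_dpoly n k).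
Proof.
elim: n t => [|n IHn] t nk t0.
  by rewrite /partial_tx /= burgers_space_jet.
apply: (burgers_time_jet nk _ t0).2 => s s0; apply: IHn => //.
by lia.
Qed.

Lemma burgers_has_partial_tx n k : (2 * n + k <= j)%N ->
  has_partial_tx n k (burgers_solution f0).
Proof.
move=> nk; split => i ik x t t0.
  have ij : (i < j)%N by lia.
  rewrite burgers_space_jet ?(ltnW ij)//.
  by have [] := is_derive_burgers_dpoly_x x t ij.
have ij : (2 * i.+1 + k <= j)%N by lia.
apply: (burgers_time_jet ij _ t0).1 => s s0; apply: partial_txE => //.
by lia.
Qed.

End FixedSolution.

Lemma heat_quotient_decay j (kappa1 kappa2 alpha : R) c :
  0 < kappa1 -> 0 < kappa2 -> 0 < alpha -> alpha < 1 -> (forall m, 0 <= c m) ->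
  exists2 C : nat -> R, (forall i, 0 <= C i) &
    forall f0, initial_data j kappa1 kappa2 alpha c f0 ->
    forall i x t, (i <= j)%N -> 0 <= t ->
    `|heat_quotient f0 i x t| <= C i * rate alpha t ^+ i.+1.
Proof.
move=> k10 k20 a0 a1 c0.
have H i : exists C : R, 0 <= C /\ ((i <= j)%N -> forall f0,
    initial_data j kappa1 kappa2 alpha c f0 -> forall x t, 0 <= t ->
    `|heat_quotient f0 i x t| <= C * rate alpha t ^+ i.+1).
  have [ij|ij] := leqP i j; last by exists 0; split => //.
  have [C C0 HC] :=
    @heat_cole_derive_decay _ j _ _ _ _ i.+1 k10 k20 a0 a1 c0 ij.
  exists C; split => // _ f0 hf0 x t t0.
  have h0 := heat_cole_gt0 k10 k20 a0 c0 hf0 x (Num.sqrt t).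
  by rewrite normrM normfV (gtr0_norm h0) ler_pdivrMr// HC.
have [C HC] := choice H.
exists C => [i|f0 hf0 i x t ij t0]; first by case: (HC i).
by have [_ ->] := HC i.
Qed.

Lemma burgers_decay j (kappa1 kappa2 alpha : R) c n k :
  0 < kappa1 -> 0 < kappa2 -> 0 < alpha -> alpha < 1 -> (forall m, 0 <= c m) ->
  (2 * n + k <= j)%N ->
  exists2 K : R, 0 <= K & forall f0, initial_data j kappa1 kappa2 alpha c f0 ->
    forall x t, 0 <= t -> `|partial_tx n k (burgers_solution f0) x t| <=
      K * rate alpha t ^+ (1 + k + 2 * n).
Proof.
move=> k10 k20 a0 a1 c0 nk.
have [C C0 HC] := heat_quotient_decay j k10 k20 a0 a1 c0.
have [K K0 HK] := deval_bounded (homog_burgers n k) C0.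
exists K => // f0 hf0 x t t0; rewrite (partial_txE k10 k20 a0 c0 hf0 x nk t0).
apply: HK; first by rewrite ltW// rate_gt0.
by move=> i ink; apply: (HC _ hf0) => //; lia.
Qed.

End Burgers.

Theorem proposition1p3 (R : realType) (j : nat) (hj : (1 <= j)%N)
    (kappa1 kappa2 : R) (hkappa1 : 0 < kappa1) (hkappa2 : 0 < kappa2)
    (alpha : R) (halpha0 : 0 < alpha) (halpha1 : alpha < 1)
    (lambda : 'I_j.+1 -> R) (hlambda : forall i : 'I_j.+1, 0 < lambda i)
    (n k : nat) (hnk : (2 * n + k <= j)%N) :
  exists K : R, 0 < K /\
    forall f0 : R -> R,
      is_Ck j f0 ->
      (forall y : R, kappa1 / (1 + `|y|) `^ alpha <= f0 y /\
                     f0 y <= kappa2 / (1 + `|y|) `^ alpha) ->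
      (forall (i : 'I_j.+1) (y : R),
         `|f0^`(i) y| <= lambda i / (1 + `|y|) `^ (alpha + (i : nat)%:R)) ->
      has_partial_tx n k (burgers_solution f0) /\
      forall t : R, 0 <= t ->
        ('N[lebesgue_measure]_(+oo)
            [EFin \o (fun x : R => partial_tx n k (burgers_solution f0) x t)] <=
         (K / (1 + t) `^ (alpha / (1 + alpha) * (1 + 2 * n%:R + k%:R)))%:E)%E.
Proof.
pose c i := lambda (inord i).
have c0 i : 0 <= c i by exact: (ltW (hlambda _)).
have [K K0 HK] := burgers_decay hkappa1 hkappa2 halpha0 halpha1 c0 hnk.
exists (K + 1); split; first by rewrite ltr_wpDl.
move=> f0 ckf0 f0b f0d.
have hf0 := initial_data_of_bounds hlambda halpha1 ckf0 f0b f0d.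
split; first exact: (burgers_has_partial_tx hkappa1 hkappa2 halpha0 c0 hf0 hnk).
move=> t t0.
have rE : rate alpha t ^+ (1 + k + 2 * n) =
    ((1 + t) `^ (alpha / (1 + alpha) * (1 + 2 * n%:R + k%:R)))^-1.
  rewrite /rate -powR_mulrn ?powR_ge0// -powRrM -powRN; congr (_ `^ _).
  by rewrite (natrD _ (1 + k)) (natrD _ 1) natrM mulNr addrAC.
have r0 : 0 <= rate alpha t ^+ (1 + k + 2 * n).
  by rewrite exprn_ge0// ltW// rate_gt0.
rewrite -rE unlock; case: ifPn => _; last by rewrite lee_fin mulr_ge0// addr_ge0.
apply/ess_supP/aeW => x /=; rewrite lee_fin (le_trans (HK _ hf0 x t t0))//.
by rewrite ler_wpM2r// lerDl.
Qed.
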